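(* Let $n\ge 2$ and let $\Delta$ be a total simplex of $\mathbf{H}^n\sqcup\partial\mathbf{H}^n$. Apply an element of $\operatorname{Isom}(\mathbf{H}^n)$ placing the incenter $o$ of $\Delta$ at the origin of the Euclidean chart $\mathbb{R}^n$ of the projective model; the resulting configurations of points of $\mathbb{R}^n$ are called the incentred Euclidean models of $\Delta$ and of its inscribed dual simplex $\Delta'$. Then: 1. The stabilizer of $\Delta^{(n)}$ in $\operatorname{Isom}(\mathbf{H}^n)$ fixes $o$, hence equals the stabilizer of the incentred Euclidean model of $\Delta$ in $\operatorname{Isom}(\mathbf{S}^{n-1})=\mathrm{O}(n)$. 2. The incentred Euclidean model of $\Delta'$ is circumscribed by the sphere centred at $o$ of Euclidean radius $\tau=\tanh\delta^n_{n-1}(\Delta)$, and it has Euclidean Gram matrix $\tau^2\cdot G(e'_k)=\tau^2\cdot(\cos\theta'_{ij})_{0\le i,j\le n}$. 3. If $\Delta$ is ideal, then its incentred Euclidean model is a Euclidean simplex inscribed in the unit sphere, with incenter at the origin, Euclidean inradius $\tanh\delta^n_{n-1}(\Delta)$, and dual Gram matrix (the Gram matrix of the outward unit normals to its hyperfaces) $G(e'_k)=(\cos\theta'_{ij})$. 4. This yields a bijective correspondence between $\operatorname{Isom}(\mathbf{H}^n)$-classes of total ideal simplices in $\partial\mathbf{H}^n$ and $\operatorname{Isom}(\mathbf{S}^{n-1})$-classes of (non-degenerate) Euclidean simplices inscribed in $\mathbf{S}^{n-1}$ with incenter at the origin.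
   Context: $\mathbf{H}^n$ is real hyperbolic space of dimension $n$ (curvature $-1$) with distance $d$ and boundary $\partial\mathbf{H}^n$. Its projective (Cayley–Klein) model in the Euclidean chart is the open unit ball $\mathbf{B}^n$ of $\mathbb{R}^n$, with $\partial\mathbf{H}^n=\mathbf{S}^{n-1}$ the unit sphere; geodesic subspaces and convex hulls are the Euclidean ones, and the stabilizer of the origin in $\operatorname{Isom}(\mathbf{H}^n)$ is the orthogonal group $\mathrm{O}(n)=\operatorname{Isom}(\mathbf{S}^{n-1})$ acting linearly. A point at hyperbolic distance $r$ from the origin is at Euclidean distance $\tanh r$ from it. A simplex $\Delta$ is a sequence of $n+1$ points $v_0,\dots,v_n$ of $\mathbf{H}^n\sqcup\partial\mathbf{H}^n$ (its vertices). It is ideal when all $v_i\in\partial\mathbf{H}^n$, and total when the vertices are affinely independent in the projective model. $\Delta^{(n)}$ is the convex hull of the vertices, the hyperface $\partial_k\Delta^{(n)}$ is the convex hull of $\{v_0,\dots,v_n\}\setminus\{v_k\}$, and $\Delta^{(n-1)}$ is the union of the hyperfaces. The inradius is $\delta^n_{n-1}(\Delta)=\max\{d(p,\Delta^{(n-1)}):p\in\Delta^{(n)}\}$ (distances computed in $\mathbf{H}^n$), and the incenter $o$ of a total simplex is the unique point of $\Delta^{(n)}$ realizing this maximum, equivalently the unique point of $\Delta^{(n)}$ equidistant to all the hyperplanes spanned by the hyperfaces. The inscribed dual simplex is $\Delta'=(v'_0,\dots,v'_n)\in(\mathbf{H}^n)^{1+n}$, where $v'_k$ is the hyperbolic orthogonal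 projection of $o$ on the hyperplane spanned by $\partial_k\Delta^{(n)}$. Let $e'_k$ be the unit tangent vector at $o$ pointing towards $v'_k$, $\theta'_{ij}$ the angle at $o$ between $e'_i$ and $e'_j$, and $G(e'_k)=(\cos\theta'_{ij})_{0\le i,j\le n}$. Euclidean simplices are also regarded as sequences of $n+1$ vertices. *)

(* Defs.v *)
From HB Require Import structures.
From mathcomp Require Import all_boot all_order all_algebra.
From mathcomp Require Import all_classical all_reals all_analysis.

Set Implicit Arguments.
Unset Strict Implicit.
Unset Printing Implicit Defensive.

Import Order.TTheory GRing.Theory Num.Theory.
Import numFieldNormedType.Exports.

Local Open Scope classical_set_scope.
Local Open Scope ring_scope.

Definition tanh (R : realType) (x : R) : R :=
  (expR x - expR (- x)) / (expR x + expR (- x)).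

Definition arcosh (R : realType) (x : R) : R :=
  ln (x + Num.sqrt (x ^+ 2 - 1)).

Section Geometry.
Context {R : realType} {n : nat}.
Implicit Types (x y p q o u w : 'rV[R]_n) (P S X : set 'rV[R]_n).

(* The library norm on 'rV[R]_n is the sup norm, hence the explicit Euclidean
   one; both induce the same topology. *)
Definition dot x y : R := \sum_i x 0 i * y 0 i.
Definition enorm x : R := Num.sqrt (dot x x).
Definition eucl_dist x y : R := enorm (x - y).

(* The projective model: H^n is the open unit ball, its boundary the unit
   sphere, and their union the closed unit ball. *)
Definition hball : set 'rV[R]_n := [set x | enorm x < 1].
Definition hsphere : set 'rV[R]_n := [set x | enorm x = 1].
Definition hcball : set 'rV[R]_n := [set x | enorm x <= 1].

(* cosh d(x, y) is minus the Lorentz product of the points of the hyperboloid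
   lying on the lines spanned by (1, x) and (1, y). *)
Definition hdist x y : R :=
  arcosh ((1 - dot x y) / Num.sqrt ((1 - dot x x) * (1 - dot y y))).

(* Riemannian metric of curvature -1 of the projective model, at q. *)
Definition hmetric q u w : R :=
  dot u w / (1 - dot q q) + dot q u * dot q w / (1 - dot q q) ^+ 2.
Definition hnorm q u : R := Num.sqrt (hmetric q u u).
Definition hangle q u w : R :=
  acos (hmetric q u w / (hnorm q u * hnorm q w)).

(* Geodesics are Euclidean segments in this model. *)
Definition unit_tangent o p : 'rV[R]_n := (hnorm o (p - o))^-1 *: (p - o).

(* An isometry of H^n, together with its (unique) continuous extension to the
   boundary; the values of g outside the closed ball are irrelevant. *)
Definition is_isom (g : 'rV[R]_n -> 'rV[R]_n) : Prop :=
  [/\ g @` hball = hball,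
      forall x y, hball x -> hball y -> hdist (g x) (g y) = hdist x y
    & {within hcball, continuous g}].

Definition orthogonal_mx (A : 'M[R]_n) : Prop := A *m A^T = 1%:M.

(* Foot in P of the geodesic perpendicular to P through p. *)
Definition hproj P p : 'rV[R]_n :=
  get [set q | [/\ P q, hball q
                 & forall x, P x -> hmetric q (x - q) (p - q) = 0]].

Definition hull m (v : 'I_m -> 'rV[R]_n) : set 'rV[R]_n :=
  [set x | exists a : 'I_m -> R,
     [/\ forall i, 0 <= a i, \sum_i a i = 1 & x = \sum_i a i *: v i]].

Definition affine_span m (v : 'I_m -> 'rV[R]_n) : set 'rV[R]_n :=
  [set x | exists a : 'I_m -> R,
     \sum_i a i = 1 /\ x = \sum_i a i *: v i].

Definition affinely_independent m (v : 'I_m -> 'rV[R]_n) : Prop :=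
  forall a : 'I_m -> R,
    \sum_i a i = 0 -> \sum_i a i *: v i = 0 -> forall i, a i = 0.

Definition gram m (v : 'I_m -> 'rV[R]_n) : 'M[R]_m :=
  \matrix_(i, j) dot (v i) (v j).

Definition simplex : Type := 'I_n.+1 -> 'rV[R]_n.
Implicit Types (v : simplex) (k : 'I_n.+1).

Definition face_vertices v k : 'I_n -> 'rV[R]_n := v \o lift k.

Definition hyperface v k : set 'rV[R]_n := hull (face_vertices v k).

Definition facets v : set 'rV[R]_n := \bigcup_k hyperface v k.

Definition total_simplex v : Prop :=
  (forall i, hcball (v i)) /\ affinely_independent v.

Definition ideal_simplex v : Prop := forall i, hsphere (v i).

Definition dist_to (d : 'rV[R]_n -> 'rV[R]_n -> R) S p : R :=
  inf [set d p q | q in S].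

(* Inradius and incenter for a distance d defined on X: the pair (X, d) is
   (hball, hdist) in the hyperbolic case and (setT, eucl_dist) in the Euclidean
   one. In the hyperbolic case ideal points are thus left out. *)
Definition facet_dist X d v p : R := dist_to d (facets v `&` X) p.

Definition inradius X d v : R :=
  sup [set facet_dist X d v p | p in hull v `&` X].

Definition is_incenter X d v o : Prop :=
  (hull v `&` X) o /\
  forall p, (hull v `&` X) p -> p <> o ->
    facet_dist X d v p < facet_dist X d v o.

Definition hinradius v : R := inradius hball hdist v.
Definition hincenter v : 'rV[R]_n := get (is_incenter hball hdist v).

Definition inscribed_dual v : simplex :=
  fun k => hproj (affine_span (face_vertices v k)) (hincenter v).

Definition dual_direction v k : 'rV[R]_n :=
  unit_tangent (hincenter v) (inscribed_dual v k).

Definition dual_angle v (i j : 'I_n.+1) : R :=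
  hangle (hincenter v) (dual_direction v i) (dual_direction v j).

Definition dual_cos_mx v : 'M[R]_n.+1 :=
  \matrix_(i, j) cos (dual_angle v i j).

Definition outward_normal v k : 'rV[R]_n :=
  get [set u | [/\ enorm u = 1,
                   forall x y, hyperface v k x -> hyperface v k y ->
                     dot u (x - y) = 0
                 & forall x, hyperface v k x -> dot u (v k - x) < 0]].

Definition euclidean_dual_gram v : 'M[R]_n.+1 := gram (outward_normal v).

Definition inscribed_incentred v : Prop :=
  [/\ affinely_independent v, forall i, enorm (v i) = 1
    & is_incenter setT eucl_dist v 0].

Definition hull_stabilizer v : set ('rV[R]_n -> 'rV[R]_n) :=
  [set h | is_isom h /\ h @` hull v = hull v].

(* The stabilizer in O(n) of the configuration of vertices, as a set. *)
Definition orthogonal_stabilizer v : set 'M[R]_n :=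
  [set A | orthogonal_mx A /\ mulmxr A @` range v = range v].

Definition isom_class v : set simplex :=
  [set g \o v | g in is_isom].

Definition orthogonal_class v : set simplex :=
  [set mulmxr A \o v | A in orthogonal_mx].

End Geometry.
Arguments simplex R n : clear implicits.

(* Main.v *)
(* A maximizer of the distance to the hyperfaces is equidistant from the
   hyperplanes they span. Writing each of these hyperplanes as the zero set of a
   linear form on Lorentz space, normalized by its Lorentz norm, there is exactly
   one ray on which all forms agree, and it is timelike because it is a positive
   combination of the vertices. Moving it to the origin by a Lorentz boost makes
   all hyperplanes tangent to one Euclidean sphere of radius tau about 0; in
   that position both the hyperbolic and the Euclidean incenter are at 0, the feet
   of the perpendiculars from 0 are tau times the unit normals, and angles at 0
   are Euclidean. An isometry of the ball is a boost followed by an orthogonal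
   map, hence is projective, which transports everything back to the original
   simplex; conversely a Euclidean incenter at 0 makes all hyperplanes tangent to
   one sphere. *)

Require Import Defs.
From HB Require Import structures.
From mathcomp Require Import all_boot all_order all_algebra.
From mathcomp Require Import all_classical all_reals all_analysis.
From mathcomp Require Import ring lra.
Import Order.TTheory GRing.Theory Num.Theory.
Import numFieldNormedType.Exports.

Set Implicit Arguments.
Unset Strict Implicit.
Unset Printing Implicit Defensive.

Local Open Scope classical_set_scope.
Local Open Scope ring_scope.

(** The obstacle is that [is_isom] only grants a distance-preserving self-map of the open ball,
    continuous up to the boundary: projectivity has to be extracted from this, and nothing is known
    of [g] outside the closed ball or of its derivative. Hence whatever has to be transported is
    first expressed by Lorentz products [1 - dot x y], which an isometry changes by positive factors
    attached to x and to y. This form covers ideal vertices, where distances make no sense, and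
    replaces differentiation when feet of perpendiculars and angles are moved. Incenters are not
    obtained by compactness either. A candidate is written down from the Lorentz norms of the facet
    normals, and its maximality is verified in the balanced position, where it rests on the
    inclusion of the simplex in the closed ball. Since [hincenter] and [hproj] are picked by [get],
    each identification needs existence together with uniqueness. *)

Section Arcosh.
Context {R : realType}.
Implicit Types x y t : R.

(** * Monotonicity of arcosh and its relation to tanh *)

Lemma subr1_sqr_gt0 t : 0 <= t -> t < 1 -> 0 < 1 - t ^+ 2.
Proof. by move=> t0 t1; rewrite subr_gt0 expr_lt1. Qed.

Lemma arcosh_arg_ge1 x : 1 <= x -> 1 <= x + Num.sqrt (x ^+ 2 - 1).
Proof. by move=> x1; rewrite -[leLHS]addr0 lerD ?sqrtr_ge0. Qed.

Lemma arcosh_ge0 x : 1 <= x -> 0 <= arcosh x.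
Proof. by move=> x1; apply/ln_ge0/arcosh_arg_ge1. Qed.

Lemma arcosh_ltr x y : 1 <= x -> x < y -> arcosh x < arcosh y.
Proof.
move=> x1 xy; have y1 : 1 <= y by rewrite (le_trans x1)// ltW.
have pos (z : R) : 1 <= z -> z + Num.sqrt (z ^+ 2 - 1) \in Num.pos.
  by move=> z1; rewrite posrE (lt_le_trans _ (arcosh_arg_ge1 z1)).
rewrite /arcosh ltr_ln ?pos//; apply: ltr_leD => //.
by rewrite ler_wsqrtr// lerD2r lerXn2r// ?nnegrE; lra.
Qed.

Lemma arcosh_ler x y : 1 <= x -> x <= y -> arcosh x <= arcosh y.
Proof.
move=> x1; rewrite le_eqVlt => /predU1P[->//|xy].
exact/ltW/arcosh_ltr.
Qed.

Lemma arcosh_inj x y : 1 <= x -> 1 <= y -> arcosh x = arcosh y -> x = y.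
Proof.
move=> x1 y1 e; case: (ltgtP x y) => // /arcosh_ltr h.
  by have := h x1; rewrite e ltxx.
by have := h y1; rewrite e ltxx.
Qed.

(** The argument of tanh is the distance from 0 to a point of Euclidean norm [t]. Its exponential is
    [(1 + t) / s], and [s ^+ 2 = (1 - t) (1 + t)] does the rest. *)
Lemma tanh_arcosh t : 0 <= t -> t < 1 ->
  tanh (arcosh (Num.sqrt (1 - t ^+ 2))^-1) = t.
Proof.
move=> t0 t1; have t2 := subr1_sqr_gt0 t0 t1.
set s := Num.sqrt (1 - t ^+ 2).
have s0 : 0 < s by rewrite sqrtr_gt0.
have s2 : s ^+ 2 = 1 - t ^+ 2 by rewrite sqr_sqrtr// ltW.
have -> : arcosh s^-1 = ln ((1 + t) / s).
  rewrite /arcosh; have -> : s^-1 ^+ 2 - 1 = (t / s) ^+ 2.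
    by rewrite -[1 in LHS](divff (lt0r_neq0 (exprn_gt0 2 s0))) expr_div_n exprVn s2;
      field; rewrite lt0r_neq0.
  by rewrite sqrtr_sqr ger0_norm ?divr_ge0 ?(ltW s0)//; congr ln; field; lra.
have p : 0 < (1 + t) / s by rewrite divr_gt0//; lra.
rewrite /tanh expRN lnK ?posrE//.
have sN0 : s != 0 by rewrite lt0r_neq0.
have tN0 : 1 + t != 0 by lra.
have -> : (1 + t) / s - ((1 + t) / s)^-1 = 2 * t / s.
  apply/eqP; rewrite -subr_eq0; apply/eqP.
  transitivity ((1 - t ^+ 2 - s ^+ 2) / (s * (1 + t))); first by field; apply/andP.
  by rewrite s2 subrr mul0r.
have -> : (1 + t) / s + ((1 + t) / s)^-1 = 2 / s.
  apply/eqP; rewrite -subr_eq0; apply/eqP.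
  transitivity ((s ^+ 2 - (1 - t ^+ 2)) / (s * (1 + t))); first by field; apply/andP.
  by rewrite s2 subrr mul0r.
by field.
Qed.

End Arcosh.

(** * Euclidean dot product and points of the ball *)

Section DotProduct.
Context {R : realType} {n : nat}.
Implicit Types (x y z : 'rV[R]_n) (a : R).

Lemma dotC x y : dot x y = dot y x.
Proof. by apply: eq_bigr => i _; rewrite mulrC. Qed.

Lemma dotDl x y z : dot (x + y) z = dot x z + dot y z.
Proof. by rewrite -big_split; apply: eq_bigr => i _; rewrite mxE mulrDl. Qed.

Lemma dotZl a x y : dot (a *: x) y = a * dot x y.
Proof. by rewrite mulr_sumr; apply: eq_bigr => i _; rewrite mxE mulrA. Qed.

Lemma dotNl x y : dot (- x) y = - dot x y.
Proof. by rewrite -scaleN1r dotZl mulN1r. Qed.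

Lemma dot0l x : dot 0 x = 0.
Proof. by rewrite -(scale0r 0) dotZl mul0r. Qed.

Lemma dotDr x y z : dot z (x + y) = dot z x + dot z y.
Proof. by rewrite dotC dotDl !(dotC z). Qed.

Lemma dotZr a x y : dot x (a *: y) = a * dot x y.
Proof. by rewrite dotC dotZl (dotC x). Qed.

Lemma dotNr x y : dot x (- y) = - dot x y.
Proof. by rewrite dotC dotNl (dotC x). Qed.

Lemma dot0r x : dot x 0 = 0.
Proof. by rewrite dotC dot0l. Qed.

Definition dotE := (dotDl, dotDr, dotNl, dotNr, dotZl, dotZr, dot0l, dot0r).

Lemma dot_suml m (F : 'I_m -> 'rV[R]_n) x :
  dot (\sum_i F i) x = \sum_i dot (F i) x.
Proof.
elim/big_rec2: _ => [|i y1 y2 _ <-]; by rewrite ?dot0l ?dotDl.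
Qed.

Lemma dot_mulmx x y (A B : 'M[R]_n) : dot (x *m A) (y *m B) = (x *m A *m B^T *m y^T) 0 0.
Proof.
have -> : x *m A *m B^T *m y^T = (x *m A) *m (y *m B)^T by rewrite trmx_mul mulmxA.
by rewrite mxE; apply: eq_bigr => i _; rewrite [(_ ^T) _ _]mxE.
Qed.

Lemma dot_adjoint x y (B : 'M[R]_n) : dot x (y *m B) = dot (x *m B^T) y.
Proof.
by have := dot_mulmx (x *m B^T) y 1%:M 1%:M; have := dot_mulmx x y 1%:M B;
  rewrite !mulmx1 trmx1 !mulmx1 => -> ->.
Qed.

Lemma dot_orthogonal x y (A : 'M[R]_n) :
  orthogonal_mx A -> dot (x *m A) (y *m A) = dot x y.
Proof.
move=> oA; rewrite dot_mulmx -(mulmxA x) oA mulmx1 mxE.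
by apply: eq_bigr => i _; rewrite mxE.
Qed.

Lemma dot_ge0 x : 0 <= dot x x.
Proof. by apply: sumr_ge0 => i _; rewrite -expr2 sqr_ge0. Qed.

Lemma dot_eq0 x : dot x x = 0 -> x = 0.
Proof.
move=> /eqP; rewrite psumr_eq0 => [/allP h|i _]; last by rewrite -expr2 sqr_ge0.
apply/rowP => i; rewrite mxE.
by have /eqP := h i (mem_index_enum i); rewrite -expr2 => /eqP; rewrite sqrf_eq0 => /eqP.
Qed.

Lemma dot_gt0 x : x <> 0 -> 0 < dot x x.
Proof.
move=> x0; rewrite lt_neqAle dot_ge0 andbT eq_sym.
by apply/eqP => /dot_eq0.
Qed.

Lemma dot_ext x y : (forall z, dot x z = dot y z) -> x = y.
Proof.
move=> h; apply/eqP; rewrite -subr_eq0; apply/eqP/dot_eq0.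
by rewrite dotDl h dotNl subrr.
Qed.

Lemma cauchy_schwarz x y : dot x y ^+ 2 <= dot x x * dot y y.
Proof.
have [->|/eqP/dot_gt0 y0] := eqVneq y 0; first by rewrite !dotE expr0n mulr0.
have e : dot (dot y y *: x - dot x y *: y) (dot y y *: x - dot x y *: y)
    = dot y y * (dot x x * dot y y - dot x y ^+ 2).
  by rewrite !dotE (dotC y x); ring.
have := dot_ge0 (dot y y *: x - dot x y *: y); rewrite e.
by rewrite pmulr_rge0// subr_ge0.
Qed.

Lemma enorm_ge0 x : 0 <= enorm x. Proof. exact: sqrtr_ge0. Qed.

Lemma enorm_sqr x : enorm x ^+ 2 = dot x x.
Proof. by rewrite sqr_sqrtr// dot_ge0. Qed.

Lemma dot_le_enorm x y : dot x y <= enorm x * enorm y.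
Proof.
rewrite -sqrtrM ?dot_ge0// (le_trans (ler_norm _))// -sqrtr_sqr.
by rewrite ler_wsqrtr// cauchy_schwarz.
Qed.

Lemma dot_unit_le1 x y : dot x x = 1 -> dot y y = 1 -> dot x y <= 1.
Proof. by move=> x1 y1; rewrite (le_trans (dot_le_enorm x y))// /enorm x1 y1 sqrtr1 mulr1. Qed.

Lemma hballP x : hball x <-> dot x x < 1.
Proof. by rewrite /hball /= -enorm_sqr expr_lt1// enorm_ge0. Qed.

Lemma hcballP x : hcball x <-> dot x x <= 1.
Proof. by rewrite /hcball /= -enorm_sqr expr_le1// enorm_ge0. Qed.

Lemma hsphereP x : hsphere x <-> dot x x = 1.
Proof.
rewrite /hsphere /=; split; first by rewrite -enorm_sqr => ->; rewrite expr1n.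
by rewrite /enorm => ->; rewrite sqrtr1.
Qed.

Lemma hball_hcball x : hball x -> hcball x. Proof. exact: ltW. Qed.

Lemma hsphere_hcball x : hsphere x -> hcball x.
Proof. by rewrite /hsphere/hcball/= => ->. Qed.

Lemma hball0 : hball (0 : 'rV[R]_n).
Proof. by apply/hballP; rewrite dot0l. Qed.

Lemma dot_lt1 x y : hball x -> hcball y -> dot x y < 1.
Proof.
move=> xb yb; apply: le_lt_trans (dot_le_enorm x y) _.
rewrite (le_lt_trans _ (xb : _ < _))// -[leRHS]mulr1.
by rewrite ler_wpM2l ?enorm_ge0.
Qed.

(** Reversed Cauchy-Schwarz inequality for timelike vectors: after [dot x y <= enorm x * enorm y]
    the difference of squares is [(enorm x - enorm y) ^+ 2]. It keeps every use of [arcosh] on the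
    half-line where it is injective. *)
Lemma hdist_arg_ge1 x y : hball x -> hball y ->
  1 <= (1 - dot x y) / Num.sqrt ((1 - dot x x) * (1 - dot y y)).
Proof.
move=> xb yb; have xy := dot_lt1 xb (hball_hcball yb).
have x1 : 0 < 1 - dot x x by move/hballP : xb; lra.
have y1 : 0 < 1 - dot y y by move/hballP : yb; lra.
rewrite ler_pdivlMr ?sqrtr_gt0 ?mulr_gt0// mul1r.
have le : 0 <= 1 - enorm x * enorm y <= 1 - dot x y.
  by rewrite lerD2l lerN2 dot_le_enorm andbT subr_ge0 mulr_ile1 ?enorm_ge0//; apply: ltW.
rewrite -(ger0_norm (_ : 0 <= 1 - dot x y)) -?sqrtr_sqr; last by lra.
apply: ler_wsqrtr.
apply: (@le_trans _ _ ((1 - enorm x * enorm y) ^+ 2)); last first.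
  by rewrite lerXn2r ?nnegrE; lra.
rewrite -!enorm_sqr -subr_ge0.
have -> : (1 - enorm x * enorm y) ^+ 2 - (1 - enorm x ^+ 2) * (1 - enorm y ^+ 2)
  = (enorm x - enorm y) ^+ 2 by ring.
exact: sqr_ge0.
Qed.

Lemma hdist_ge0 x y : hball x -> hball y -> 0 <= hdist x y.
Proof. by move=> xb yb; apply/arcosh_ge0/hdist_arg_ge1. Qed.

Lemma hdist0E x : hdist 0 x = arcosh (Num.sqrt (1 - dot x x))^-1.
Proof. by rewrite /hdist !dot0l subr0 !mul1r. Qed.

End DotProduct.

(** * Lorentz transformations of the ball *)

Section Moebius.
Context {R : realType} {n : nat}.
Implicit Types (x y z o : 'rV[R]_n) (g f : 'rV[R]_n -> 'rV[R]_n) (m : 'rV[R]_n -> R).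

(* The map induced on the ball by a Lorentz transformation: [m x] is the time
   coordinate of the image of (1, x). *)
Definition moebius m g : Prop :=
  [/\ forall x, hcball x -> 0 < m x,
      forall x y, hcball x -> hcball y ->
        1 - dot (g x) (g y) = (1 - dot x y) / (m x * m y),
      exists a b, forall x, m x = a + dot b x
    & exists c B, forall x, hcball x -> m x *: g x = c + x *m B].

(** Relativistic velocity subtraction: the Lorentz boost taking the line of (1, o) to the time axis,
    read in the projective chart. The coefficient [(1 - s) / dot o o] of the component along [o] is
    written [1 / (1 + s)], which also makes sense at [o = 0]. *)
Definition boost o x : 'rV[R]_n :=
  let s := Num.sqrt (1 - dot o o) in
  (1 - dot o x)^-1 *: (s *: x + (dot o x / (1 + s) - 1) *: o).

Lemma boost_self o : hball o -> boost o o = 0.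
Proof.
move=> /hballP ob; rewrite /boost.
set s := Num.sqrt _.
have s0 : 0 < s by rewrite sqrtr_gt0; lra.
have -> : dot o o = 1 - s ^+ 2 by rewrite sqr_sqrtr; lra.
rewrite -scalerDl (_ : s + _ = 0) ?scale0r ?scaler0//.
by field; lra.
Qed.

Lemma boostK o x : hball o -> hcball x -> boost (- o) (boost o x) = x.
Proof.
move=> ob xb; have ox := dot_lt1 ob xb.
move/hballP : ob => ob.
rewrite /boost !dotE opprK; set s := Num.sqrt (1 - dot o o).
have s0 : 0 < s by rewrite sqrtr_gt0; lra.
have oo : dot o o = 1 - s ^+ 2 by rewrite sqr_sqrtr; lra.
rewrite oo; set d := dot o x in ox *.
have d0 : 1 - d != 0 by lra.
have s1 : 1 + s != 0 by lra.
have sN0 : s != 0 by lra.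
set y := _ * (s * d + _); have yE : y = - 1 + s ^+ 2 / (1 - d).
  by rewrite /y; field; rewrite d0.
have -> : Num.sqrt (1 - - - (1 - s ^+ 2)) = s.
  by rewrite opprK subKr sqrtr_sqr ger0_norm// ltW.
have -> : (1 + y)^-1 = (1 - d) / s ^+ 2.
  by rewrite yE addrA subrr add0r invf_div.
rewrite !(scalerDr, scalerN, scalerA) -addrA -scalerBl.
rewrite [X in X *: x](_ : _ = 1); last by field; rewrite d0 sN0.
rewrite [X in X *: o](_ : _ = 0) ?scale1r ?scale0r ?addr0//.
by rewrite yE; field; rewrite s1 d0 sN0.
Qed.

Lemma moebius_boost o : hball o ->
  moebius (fun x => (1 - dot o x) / Num.sqrt (1 - dot o o)) (boost o).
Proof.
move=> ob; have oo1 : dot o o < 1 by apply/hballP.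
pose s := Num.sqrt (1 - dot o o).
have s0 : 0 < s by rewrite sqrtr_gt0; lra.
have oo : dot o o = 1 - s ^+ 2 by rewrite sqr_sqrtr; lra.
have sN0 : s != 0 by lra.
have s1 : 1 + s != 0 by lra.
have d0 x : hcball x -> 0 < 1 - dot o x by move/(dot_lt1 ob); lra.
split.
- by move=> x xb; rewrite divr_gt0// d0.
- move=> x y xb yb; have := d0 x xb; have := d0 y yb => y0 x0.
  rewrite /boost -/s !dotE oo (dotC x o).
  by field; rewrite ?sN0 ?s1 /=; apply/andP; split; lra.
- exists s^-1, (- s^-1 *: o) => x.
  by rewrite -/s dotZl mulrBl mul1r mulrC mulNr.
(* The spatial part of the Lorentz matrix of the boost. *)
- exists (- s^-1 *: o), (1%:M + (s * (1 + s))^-1 *: (o^T *m o)) => x xb.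
  have x0 := d0 x xb.
  have -> : x *m (1%:M + (s * (1 + s))^-1 *: (o^T *m o))
     = x + ((s * (1 + s))^-1 * dot o x) *: o.
    rewrite mulmxDr mulmx1 -scalemxAr mulmxA.
    have -> : x *m o^T = (dot o x)%:M.
      by apply/rowP => i; rewrite !ord1 !mxE; apply: eq_bigr => k _; rewrite mxE mulrC.
    by rewrite mul_scalar_mx scalerA.
  rewrite /boost -/s !(scalerDr, scalerA) addrCA; congr (_ + _).
    by rewrite -[RHS]scale1r; congr (_ *: _); field; rewrite ?sN0 ?s1 /=; lra.
  by rewrite -scalerDl; congr (_ *: _); field; rewrite ?sN0 ?s1 /=; lra.
Qed.

Lemma moebius_orthogonal (A : 'M[R]_n) :
  orthogonal_mx A -> moebius (fun=> 1) (mulmxr A).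
Proof.
move=> oA; split => [//|x y _ _||].
- by rewrite /= dot_orthogonal// mulr1 divr1.
- by exists 1, 0 => x; rewrite dot0l addr0.
- by exists 0, A => x _; rewrite scale1r add0r.
Qed.

Lemma moebius_hball m g x : moebius m g -> hball x -> hball (g x).
Proof.
move=> [mp conf _ _] xb; have xc := hball_hcball xb.
apply/hballP; rewrite -subr_gt0 conf// divr_gt0 ?mulr_gt0 ?mp//.
by move/hballP : xb; rewrite subr_gt0.
Qed.

Lemma moebius_hcball m g x : moebius m g -> hcball x -> hcball (g x).
Proof.
move=> [mp conf _ _] xc.
apply/hcballP; rewrite -subr_ge0 conf// divr_ge0 ?mulr_ge0 ?(ltW (mp _ _))//.
by move/hcballP : xc; rewrite subr_ge0.
Qed.

Lemma moebius_hsphere m g x : moebius m g -> hsphere x -> hsphere (g x).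
Proof.
move=> [mp conf _ _] xs; have xc := hsphere_hcball xs; apply/hsphereP.
have : 1 - dot (g x) (g x) = 0.
  by rewrite conf//; move/hsphereP : xs => ->; rewrite subrr mul0r.
by move/eqP; rewrite subr_eq0 => /eqP.
Qed.

Lemma moebius_hdist m g x y : moebius m g -> hball x -> hball y ->
  hdist (g x) (g y) = hdist x y.
Proof.
move=> [mp conf _ _] xb yb; have xc := hball_hcball xb; have yc := hball_hcball yb.
have [mx my] := (mp x xc, mp y yc).
move/hballP : (xb) => x1; move/hballP : (yb) => y1.
rewrite /hdist !conf//; congr arcosh.
have -> : (1 - dot x x) / (m x * m x) * ((1 - dot y y) / (m y * m y))
  = (1 - dot x x) * (1 - dot y y) * ((m x * m y)^-1) ^+ 2 by field; lra.
rewrite sqrtrM ?mulr_ge0//; try lra.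
rewrite sqrtr_sqr ger0_norm ?invr_ge0 ?mulr_ge0 ?(ltW mx) ?(ltW my)//.
have s0 : 0 < Num.sqrt ((1 - dot x x) * (1 - dot y y)).
  by rewrite sqrtr_gt0 mulr_gt0//; lra.
by field; rewrite !lt0r_neq0.
Qed.

Lemma moebius_comp m1 g1 m2 g2 : moebius m1 g1 -> moebius m2 g2 ->
  exists m, moebius m (g2 \o g1).
Proof.
move=> M1 M2; have g1b := moebius_hcball M1.
have [p1 c1 [a1 [b1 e1]] [k1 [B1 l1]]] := M1.
have [p2 c2 [a2 [b2 e2]] [k2 [B2 l2]]] := M2.
(* Multipliers form a cocycle, [m1 x * m2 (g1 x)], but this product is affine only on the ball; the
   composed affine formula is affine everywhere and agrees with it there. *)
pose mm x := a2 * m1 x + dot b2 (k1 + x *m B1).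
have mmE x : hcball x -> mm x = m1 x * m2 (g1 x).
  by move=> xb; rewrite e2 mulrDr -dotZr l1// /mm mulrC.
exists mm; split.
- by move=> x xb; rewrite mmE// mulr_gt0 ?p1 ?p2//; exact: g1b.
- move=> x y xb yb; rewrite /= c2 ?c1 ?mmE//; try exact: g1b.
  have := (p1 x xb, p1 y yb, p2 _ (g1b x xb), p2 _ (g1b y yb)) => -[[[? ?] ?] ?].
  by field; lra.
- exists (a2 * a1 + dot b2 k1), (a2 *: b1 + b2 *m B1^T) => x.
  by rewrite /mm e1 !dotE dot_adjoint; ring.
- exists (a1 *: k2 + k1 *m B2), (b1^T *m k2 + B1 *m B2) => x xb.
  rewrite mmE// -scalerA /= l2; last exact: g1b.
  rewrite scalerDr scalemxAl l1// mulmxDl mulmxDr !mulmxA.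
  have -> : x *m b1^T = (dot b1 x)%:M.
    by apply/rowP => i; rewrite !ord1 !mxE; apply: eq_bigr => k _; rewrite mxE mulrC.
  rewrite mul_scalar_mx e1 scalerDl.
  by rewrite -!addrA; congr (_ + _); rewrite addrCA.
Qed.

Lemma dot_delta x i : dot x (delta_mx 0 i) = x 0 i.
Proof.
rewrite /dot (bigD1 i)//= mxE !eqxx mulr1 big1 ?addr0// => j ji.
by rewrite mxE (negbTE ji) andbF mulr0.
Qed.

(* The rows of the matrix are the images of an orthonormal frame, halved so as
   to fit in the open ball. *)
Lemma dot_preserving_linear (S : set 'rV[R]_n) f : hball `<=` S ->
  (forall x y, S x -> S y -> dot (f x) (f y) = dot x y) ->
  exists2 A, orthogonal_mx A & forall x, S x -> f x = x *m A.
Proof.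
move=> bS fd; pose e i : 'rV[R]_n := 2^-1 *: delta_mx 0 i.
have ee i j : dot (e i) (e j) = 4^-1 * (i == j)%:R.
  by rewrite !dotE dot_delta mxE eqxx/= eq_sym; field.
have Se i : S (e i) by apply/bS/hballP; rewrite ee eqxx mulr1; lra.
pose A : 'M[R]_n := \matrix_(i, j) (2 * f (e i) 0 j).
have rA i : row i A = 2 *: f (e i) by apply/rowP => j; rewrite !mxE.
have oA : orthogonal_mx A.
  apply/matrixP => i j; rewrite !mxE.
  transitivity (dot (row i A) (row j A)).
    by apply: eq_bigr => k _; rewrite !mxE.
  by rewrite !rA !dotE fd// ee; field.
exists A => // x Sx.
have h : f x *m A^T = x.
  apply/rowP => i; rewrite mxE.
  transitivity (dot (f x) (row i A)); first by apply: eq_bigr => k _; rewrite !mxE.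
  by rewrite rA dotZr fd// dotZr dot_delta; field.
by rewrite -[in RHS]h -mulmxA (mulmx1C oA) mulmx1.
Qed.

(** The conformal identity at (0, 0), then at (0, x), forces [m = 1] on the closed ball, so [g]
    preserves dot products there. *)
Lemma moebius_fix0 m g : moebius m g -> g 0 = 0 ->
  exists2 A, orthogonal_mx A & forall x, hcball x -> g x = x *m A.
Proof.
move=> [mp conf _ _] g0; have c0 := hball_hcball (@hball0 R n).
have m0 : m 0 = 1.
  have := conf 0 0 c0 c0; rewrite g0 !dotE subr0 => h.
  have : m 0 * m 0 = 1 by apply: invr_inj; rewrite invr1 h mul1r.
  by move/eqP; rewrite -expr2 sqrf_eq1 => /orP[]/eqP//; have := mp 0 c0; lra.
have m1 x : hcball x -> m x = 1.
  move=> xc; have := conf 0 x c0 xc; rewrite g0 !dotE m0 subr0 !mul1r => h.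
  by apply: invr_inj; rewrite -h invr1.
apply: dot_preserving_linear => [x|x y xc yc]; first exact: hball_hcball.
have := conf x y xc yc; rewrite !m1// mulr1 divr1 => h.
by rewrite -[LHS](subKr 1) h subKr.
Qed.

(** * Continuity up to the boundary, and isometries as Lorentz transformations *)

Lemma continuous_mulmx (A : 'M[R]_n) : continuous (fun x => x *m A).
Proof.
under [X in continuous X]funext do rewrite mulmx_sum_row.
apply: continuous_big => [|i _ x]; first exact: add_continuous.
exact: (cvgZr_tmp (@coord_continuous _ _ _ 0 i x)).
Qed.

Lemma continuous_dot o : continuous (dot o).
Proof.
apply: continuous_big => [|i _ x]; first exact: add_continuous.
exact: (cvgMl_tmp (@coord_continuous _ _ _ 0 i x)).
Qed.

Lemma moebius_continuous m g : moebius m g -> {within hcball, continuous g}.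
Proof.
move=> [mp conf [a [b e]] [c [B l]]].
apply: (@subspace_eq_continuous _ _ _ (fun x => (m x)^-1 *: (c + x *m B))).
  move=> x; rewrite inE => xc /=; rewrite -l// scalerA mulVf ?scale1r//.
  by rewrite lt0r_neq0 ?mp.
apply: continuous_in_subspaceT => x; rewrite inE => xc.
have hB : c + y *m B @[y --> x] --> c + x *m B.
  exact: (cvgD (cvg_cst c) (@continuous_mulmx B x)).
have mc : m y @[y --> x] --> m x.
  by rewrite (funext e); exact: (cvgD (cvg_cst a) (@continuous_dot b x)).
have mx0 : m x != 0 by rewrite lt0r_neq0 ?mp.
have hm : (m y)^-1 @[y --> x] --> (m x)^-1 by exact: (cvgV mx0 mc).
exact: (cvgZ hm hB).
Qed.

Lemma hcball_scale (t : R) x : 0 <= t -> t < 1 -> hcball x -> hball (t *: x).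
Proof.
move=> t0 t1 /hcballP xc; apply/hballP; rewrite !dotE mulrA -expr2.
have t2 : t ^+ 2 < 1 by rewrite expr_lt1.
apply: le_lt_trans t2; rewrite -[leRHS]mulr1 ler_wpM2l//.
exact: sqr_ge0.
Qed.

(** A point x of the closed ball is the limit of [t *: x] as t tends to 1 from the left, along
    points of the open ball. This carries identities between isometries to ideal points. *)
Lemma continuous_hball_ext f1 f2 :
  {within hcball, continuous f1} -> {within hcball, continuous f2} ->
  (forall x, hball x -> f1 x = f2 x) -> forall x, hcball x -> f1 x = f2 x.
Proof.
move=> /subspace_continuousP h1 /subspace_continuousP h2 h x xc.
have tx : (t *: x) @[t --> (1 : R)^'-] --> within hcball (nbhs x).
  have tx1 : t *: x @[t --> (1 : R)^'-] --> x.
    rewrite -[X in _ --> X]scale1r; apply: cvgZr_tmp.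
    by apply: cvg_at_left_filter; exact: cvg_id.
  move=> U xU; have {}tx1 := tx1 _ xU; rewrite !nbhs_simpl/=.
  near=> t.
  have tb : hcball (t *: x).
    apply/hball_hcball/hcball_scale => //.
    by apply/ltW; near: t; apply: nbhs_left_gt.
  by move: tb; near: t.
have l1 : f1 (t *: x) @[t --> (1 : R)^'-] --> f1 x by exact: (cvg_comp _ _ tx (h1 x xc)).
have l2 : f2 (t *: x) @[t --> (1 : R)^'-] --> f2 x by exact: (cvg_comp _ _ tx (h2 x xc)).
apply: (cvg_unique (@norm_hausdorff R 'rV[R]_n) l1).
apply: cvg_trans l2; apply: near_eq_cvg.
near=> t; apply/esym/h/hcball_scale => //.
by apply/ltW; near: t; apply: nbhs_left_gt.
Unshelve. all: by end_near.
Qed.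

Lemma moebius_isom m g m' g' : moebius m g -> moebius m' g' ->
  (forall x, hcball x -> g (g' x) = x) -> is_isom g.
Proof.
move=> M M' gK; split.
- apply/seteqP; split => [_ [x xb <-]|x xb]; first exact: moebius_hball M _.
  exists (g' x); first exact: moebius_hball M' _.
  exact/gK/hball_hcball.
- by move=> x y; exact: moebius_hdist M.
- exact: moebius_continuous M.
Qed.

Lemma hball_boostN o : hball o -> hball (- o).
Proof. by move=> /hballP ob; apply/hballP; rewrite !dotE opprK. Qed.

(** With [p] the preimage of 0, [f] fixes 0. Its distances to 0 then give preservation of norms, and
    with the norms known the other distances give preservation of dot products, so [f] is linear and
    orthogonal on the ball. Continuity extends the resulting formula for [g] to the boundary. *)
Lemma isom_moebius g : is_isom g ->
  (exists m, moebius m g) /\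
  exists g', [/\ exists m', moebius m' g',
    forall x, hcball x -> g' (g x) = x & forall x, hcball x -> g (g' x) = x].
Proof.
move=> [gb gd gc].
have [p pb gp] : (g @` hball) 0 by rewrite gb; exact: hball0.
have Npb := hball_boostN pb.
have bK x : hcball x -> boost p (boost (- p) x) = x.
  by move=> xc; have := boostK Npb xc; rewrite opprK.
have bp0 : boost (- p) 0 = p.
  by have := boostK pb (hball_hcball pb); rewrite boost_self.
have Mp := moebius_boost pb; have MN := moebius_boost Npb.
pose f := g \o boost (- p).
have fb x : hball x -> hball (f x).
  by move=> xb; rewrite -gb; exists (boost (- p) x) => //; exact: moebius_hball MN _.
have fd x y : hball x -> hball y -> hdist (f x) (f y) = hdist x y.
  move=> xb yb; rewrite gd; try exact: moebius_hball MN _.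
  exact: moebius_hdist MN _ _.
have f0 : f 0 = 0 by rewrite /f /= bp0.
have s0 x : hball x -> 0 < Num.sqrt (1 - dot x x).
  by move=> /hballP xb; rewrite sqrtr_gt0; lra.
have fnorm x : hball x -> dot (f x) (f x) = dot x x.
  move=> xb; have := fd 0 x (@hball0 _ _) xb; rewrite f0 /hdist.
  move/arcosh_inj => /(_ (hdist_arg_ge1 (@hball0 _ _) (fb x xb))).
  move=> /(_ (hdist_arg_ge1 (@hball0 _ _) xb)).
  rewrite !dotE subr0 !mul1r => /invr_inj h.
  have := f_equal (fun t => t ^+ 2) h.
  move/hballP : (xb) => ?; move/hballP : (fb x xb) => ?.
  by rewrite !sqr_sqrtr; lra.
have fdot x y : hball x -> hball y -> dot (f x) (f y) = dot x y.
  move=> xb yb; have := fd x y xb yb.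
  move/arcosh_inj => /(_ (hdist_arg_ge1 (fb x xb) (fb y yb)) (hdist_arg_ge1 xb yb)).
  rewrite !fnorm//; set s := Num.sqrt _.
  have s1 : 0 < s.
    by move/hballP : xb => ?; move/hballP : yb => ?; rewrite sqrtr_gt0 mulr_gt0//; lra.
  move/(congr1 (fun t => t * s)); rewrite !divfK ?lt0r_neq0// => h.
  by rewrite -[LHS](subKr 1) h subKr.
have [A oA fA] := dot_preserving_linear (fun x xb => xb) fdot.
have MA := moebius_orthogonal oA.
have oAT : orthogonal_mx A^T by rewrite /orthogonal_mx trmxK; exact: mulmx1C.
have [m1 M1] := moebius_comp Mp MA.
have [m2 M2] := moebius_comp (moebius_orthogonal oAT) MN.
have gE x : hcball x -> g x = boost p x *m A.
  apply: (continuous_hball_ext gc (moebius_continuous M1)).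
  move=> y yb /=; rewrite -fA; last exact: moebius_hball Mp _.
  by rewrite /f/= boostK//; exact: hball_hcball.
split.
  exists m1; move: M1 => [? c1 ? [c [B l1]]]; split => //.
    by move=> x y xc yc; rewrite !gE//; exact: c1.
  by exists c, B => x xc; rewrite gE//; exact: l1.
exists (boost (- p) \o mulmxr A^T); split; first by exists m2.
  by move=> x xc /=; rewrite gE// -mulmxA oA mulmx1 boostK.
move=> x xc /=; rewrite gE; last exact: moebius_hcball M2 _.
rewrite bK; first by rewrite -mulmxA (mulmx1C oA) mulmx1.
exact: (moebius_hcball (moebius_orthogonal oAT)).
Qed.

End Moebius.

(** * Invariance of hulls and incenters *)

Section Isometries.
Context {R : realType} {n : nat}.
Implicit Types (x y z o p q : 'rV[R]_n) (g h : 'rV[R]_n -> 'rV[R]_n) (v w : simplex R n).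

Lemma isom_inverse g : is_isom g ->
  exists g', [/\ is_isom g', forall x, hcball x -> g' (g x) = x
               & forall x, hcball x -> g (g' x) = x].
Proof.
move=> gi; have [[m M] [g' [[m' M'] g'g gg']]] := isom_moebius gi.
by exists g'; split => //; exact: moebius_isom M' M g'g.
Qed.

Lemma isom_comp g h : is_isom g -> is_isom h -> is_isom (h \o g).
Proof.
move=> gi hi; have [[m M] [g' [[m' M'] g'g gg']]] := isom_moebius gi.
have [[k K] [h' [[k' K'] h'h hh']]] := isom_moebius hi.
have [mk MK] := moebius_comp M K; have [mk' MK'] := moebius_comp K' M'.
apply: (moebius_isom MK MK') => x xc /=; rewrite gg' ?hh'//.
exact: moebius_hcball K' _.
Qed.

Lemma isom_boost o : hball o -> is_isom (boost o).
Proof.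
move=> ob; have Nob := hball_boostN ob.
apply: (moebius_isom (moebius_boost ob) (moebius_boost Nob)) => x xc.
by have := boostK Nob xc; rewrite opprK.
Qed.

Lemma orthogonal_trmx (A : 'M[R]_n) : orthogonal_mx A -> orthogonal_mx A^T.
Proof. by move=> oA; rewrite /orthogonal_mx trmxK; exact: mulmx1C. Qed.

Lemma orthogonal_mulmx (A B : 'M[R]_n) :
  orthogonal_mx A -> orthogonal_mx B -> orthogonal_mx (A *m B).
Proof.
by move=> oA oB; rewrite /orthogonal_mx trmx_mul mulmxA -(mulmxA A) oB mulmx1.
Qed.

Lemma isom_orthogonal (A : 'M[R]_n) : orthogonal_mx A -> is_isom (mulmxr A).
Proof.
move=> oA; have oAT := orthogonal_trmx oA.
apply: (moebius_isom (moebius_orthogonal oA) (moebius_orthogonal oAT)) => x _ /=.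
by rewrite -mulmxA (mulmx1C oA) mulmx1.
Qed.

Lemma isom_id : is_isom (@id 'rV[R]_n).
Proof.
have o1 : orthogonal_mx (1%:M : 'M[R]_n) by rewrite /orthogonal_mx trmx1 mulmx1.
by have := isom_orthogonal o1; congr is_isom; apply/funext => x /=; rewrite mulmx1.
Qed.

Lemma isom_fix0 g : is_isom g -> g 0 = 0 ->
  exists2 A, orthogonal_mx A & forall x, hcball x -> g x = x *m A.
Proof. by move=> /isom_moebius[[m M] _]; exact: moebius_fix0 M. Qed.

Lemma isom_hball g x : is_isom g -> hball x -> hball (g x).
Proof. by move=> /isom_moebius[[m M] _]; exact: moebius_hball M. Qed.

Lemma isom_hcball g x : is_isom g -> hcball x -> hcball (g x).
Proof. by move=> /isom_moebius[[m M] _]; exact: moebius_hcball M. Qed.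

Lemma isom_hsphere g x : is_isom g -> hsphere x -> hsphere (g x).
Proof. by move=> /isom_moebius[[m M] _]; exact: moebius_hsphere M. Qed.

(** Linearity of the Lorentz transformation on a combination of the vectors (1, z i). The total
    weight is left free: total 1 serves affine combinations, total 0 affine relations. *)
Lemma moebius_sum m g : moebius m g -> exists a b c B,
  [/\ forall x, m x = a + dot b x,
      forall x, hcball x -> m x *: g x = c + x *m B
    & forall N (z : 'I_N -> 'rV[R]_n) (r : 'I_N -> R), (forall i, hcball (z i)) ->
      \sum_i r i * m (z i) = (\sum_i r i) * a + dot b (\sum_i r i *: z i) /\
      \sum_i (r i * m (z i)) *: g (z i)
        = (\sum_i r i) *: c + (\sum_i r i *: z i) *m B].
Proof.
move=> [_ _ [a [b e]] [c [B l]]]; exists a, b, c, B; split => // N z r zc; split.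
  rewrite dotC dot_suml mulr_suml -big_split; apply: eq_bigr => i _.
  by rewrite e mulrDr dotZl (dotC b).
rewrite scaler_suml mulmx_suml -big_split; apply: eq_bigr => i _.
by rewrite -scalerA l// scalerDr -scalemxAl.
Qed.

(** A projective map multiplies the barycentric weight of [z i] by [m (z i) / m x]. On the closed
    ball this factor is positive, which is why hulls are preserved. *)
Lemma moebius_weights m g N (z : 'I_N -> 'rV[R]_n) (r : 'I_N -> R) x :
  moebius m g -> (forall i, hcball (z i)) -> hcball x ->
  \sum_i r i = 1 -> x = \sum_i r i *: z i ->
  \sum_i (r i * m (z i) / m x) = 1 /\
  g x = \sum_i (r i * m (z i) / m x) *: g (z i).
Proof.
move=> M zc xc r1 xE; have mx0 : m x != 0 by case: M => mp *; rewrite lt0r_neq0 ?mp.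
have [a [b [c [B [e l s]]]]] := moebius_sum M.
have [s1 s2] := s N z r zc; rewrite r1 -xE in s1 s2; split.
  by rewrite -mulr_suml s1 mul1r -e divff.
apply: (scalerI mx0); rewrite l// scaler_sumr -[c]scale1r -s2.
by apply: eq_bigr => i _; rewrite scalerA; congr (_ *: _); field.
Qed.

(** Expanding one factor of [dot x x] over the vertices gives [enorm x ^+ 2 <= enorm x]. *)
Lemma hull_hcball N (z : 'I_N -> 'rV[R]_n) :
  (forall i, hcball (z i)) -> hull z `<=` hcball.
Proof.
move=> zc x [a [a0 a1 xE]]; rewrite /hcball/=.
have [->|xn0] := eqVneq (enorm x) 0; first exact: ler01.
have xp : 0 < enorm x by rewrite lt0r xn0 enorm_ge0.
rewrite -(ler_pM2r xp) mul1r -expr2 enorm_sqr [X in dot X _]xE dot_suml.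
apply: (@le_trans _ _ (\sum_i a i * enorm x)); last by rewrite -mulr_suml a1 mul1r.
apply: ler_sum => i _; rewrite dotZl ler_wpM2l//.
apply: (le_trans (dot_le_enorm _ _)).
by rewrite ler_piMl ?enorm_ge0//; exact: zc.
Qed.

Lemma isom_hull_sub g N (z : 'I_N -> 'rV[R]_n) x :
  is_isom g -> (forall i, hcball (z i)) -> hull z x -> hull (g \o z) (g x).
Proof.
move=> gi zc zx; have xc := hull_hcball zc zx; move: zx => [a [a0 a1 xE]].
have [[m M] _] := isom_moebius gi.
have [s1 s2] := moebius_weights M zc xc a1 xE.
exists (fun i => a i * m (z i) / m x); split => // i.
by case: M => mp *; rewrite divr_ge0 ?mulr_ge0 ?(ltW (mp _ _)).
Qed.

Lemma isom_hull g N (z : 'I_N -> 'rV[R]_n) :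
  is_isom g -> (forall i, hcball (z i)) -> hull (g \o z) = g @` hull z.
Proof.
move=> gi zc; have [g' [gi' g'g gg']] := isom_inverse gi.
have gzc i : hcball ((g \o z) i) by exact: isom_hcball.
apply/seteqP; split => [y zy|_ [x zx <-]]; last exact: isom_hull_sub.
exists (g' y); last by rewrite gg'//; exact: hull_hcball zy.
have := isom_hull_sub gi' gzc zy; congr (hull _ _).
by apply/funext => i /=; rewrite g'g.
Qed.

Lemma isom_affine_span g N (z : 'I_N -> 'rV[R]_n) x :
  is_isom g -> (forall i, hcball (z i)) -> hcball x ->
  affine_span z x -> affine_span (g \o z) (g x).
Proof.
move=> gi zc xc [a [a1 xE]]; have [[m M] _] := isom_moebius gi.
have [s1 s2] := moebius_weights M zc xc a1 xE.
by exists (fun i => a i * m (z i) / m x).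
Qed.

(** A relation [r] between the images is pulled back by the inverse isometry to a relation between
    the [z i] with coefficients [r i * m (g (z i))]; the multipliers are positive, so [r]
    vanishes. *)
Lemma isom_affinely_independent g N (z : 'I_N -> 'rV[R]_n) :
  is_isom g -> (forall i, hcball (z i)) ->
  affinely_independent z -> affinely_independent (g \o z).
Proof.
move=> gi zc zi r r0 rz i.
have [g' [gi' g'g gg']] := isom_inverse gi; have [[m M] _] := isom_moebius gi'.
have gzc j : hcball ((g \o z) j) by exact: isom_hcball.
have [a [b [c [B [e l s]]]]] := moebius_sum M.
have [s1 s2] := s N (g \o z) r gzc; rewrite r0 rz mul0r dot0r addr0 in s1.
rewrite r0 rz scale0r mul0mx addr0 in s2.
have h : r i * m (g (z i)) = 0.
  apply: (zi _ s1); rewrite -[RHS]s2; apply: eq_bigr => j _.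
  by rewrite /= g'g.
by move/eqP : h; rewrite mulf_eq0 => /orP[/eqP//|/eqP]; case: M => mp _ _ _;
  have := mp _ (gzc i) => /= /[swap] ->; rewrite ltxx.
Qed.

Lemma isom_total g v : is_isom g -> total_simplex v -> total_simplex (g \o v).
Proof.
move=> gi [vc vi]; split; last exact: isom_affinely_independent.
by move=> i; exact: isom_hcball.
Qed.

Lemma isom_ideal g v : is_isom g -> ideal_simplex v -> ideal_simplex (g \o v).
Proof. by move=> gi vs i; exact: isom_hsphere. Qed.

Lemma image_isom_hball g (S : set 'rV[R]_n) : is_isom g -> S `<=` hcball ->
  (g @` S) `&` hball = g @` (S `&` hball).
Proof.
move=> gi Sc; have [g' [gi' g'g gg']] := isom_inverse gi.
apply/seteqP; split => [y [[x Sx <-] yb]|_ [x [Sx xb] <-]].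
  exists x => //; split => //; rewrite -(g'g x); last exact: Sc.
  exact: isom_hball.
by split; [exists x|exact: isom_hball].
Qed.

Lemma facets_hcball v : (forall i, hcball (v i)) -> facets v `<=` hcball.
Proof. by move=> vc x [k _]; apply: hull_hcball => i; exact: vc. Qed.

Lemma isom_facets g v : is_isom g -> (forall i, hcball (v i)) ->
  facets (g \o v) = g @` facets v.
Proof.
move=> gi vc; apply/seteqP; split => [y [k _]|_ [x [k _ xk] <-]].
  rewrite /hyperface (_ : face_vertices _ k = g \o face_vertices v k)//.
  rewrite isom_hull// => [[x xk <-]|i]; last exact: vc.
  by exists x => //; exists k.
exists k => //; apply: isom_hull_sub => // i; exact: vc.
Qed.

Lemma isom_facet_dist g v p : is_isom g -> (forall i, hcball (v i)) -> hball p ->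
  facet_dist hball hdist (g \o v) (g p) = facet_dist hball hdist v p.
Proof.
move=> gi vc pb; have [[m M] _] := isom_moebius gi.
rewrite /facet_dist /dist_to isom_facets// image_isom_hball//; last exact: facets_hcball.
congr inf; rewrite image_comp; apply: eq_imagel => q [_ qb] /=.
exact: moebius_hdist M _ _.
Qed.

Lemma isom_hinradius g v : is_isom g -> (forall i, hcball (v i)) ->
  hinradius (g \o v) = hinradius v.
Proof.
move=> gi vc; rewrite /hinradius /inradius isom_hull// image_isom_hball//; last exact: hull_hcball.
congr sup; rewrite image_comp; apply: eq_imagel => q [_ qb] /=.
exact: isom_facet_dist.
Qed.

Lemma isom_incenter g v o : is_isom g -> (forall i, hcball (v i)) ->
  is_incenter hball hdist v o -> is_incenter hball hdist (g \o v) (g o).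
Proof.
move=> gi vc [ovb om]; split.
  by rewrite isom_hull// image_isom_hball//; exact: hull_hcball.
rewrite isom_hull// image_isom_hball//; last exact: hull_hcball.
move=> _ [p [pv pb] <-] pNo.
rewrite !isom_facet_dist//; last by case: ovb.
by apply: om => // po; apply: pNo; rewrite po.
Qed.

Lemma incenter_unique X d v o o' :
  is_incenter X d v o -> is_incenter X d v o' -> o = o'.
Proof.
move=> [oX om] [oX' om']; apply: contrapT => oo'.
by have := lt_trans (om _ oX' (nesym oo')) (om' _ oX oo'); rewrite ltxx.
Qed.

Lemma hincenterE v o : is_incenter hball hdist v o -> hincenter v = o.
Proof. by move=> vo; apply: get_unique => // y vy; exact: incenter_unique vy vo. Qed.

(** A certificate common to both geometries: the infimum over the facets has to be computed at [o]
    alone, while at any other point a single facet point closer than [r] bounds it strictly. *)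
Lemma incenter_by_dist X d v o (r : R) :
  (forall p q, X p -> X q -> 0 <= d p q) ->
  (hull v `&` X) o ->
  (forall q, (facets v `&` X) q -> r <= d o q) ->
  (exists2 q, (facets v `&` X) q & d o q = r) ->
  (forall p, (hull v `&` X) p -> p <> o ->
     exists2 q, (facets v `&` X) q & d p q < r) ->
  is_incenter X d v o /\ inradius X d v = r.
Proof.
move=> d0 ovX oge [q0 q0X oq0] plt.
have dist_le p q : (hull v `&` X) p -> (facets v `&` X) q -> facet_dist X d v p <= d p q.
  move=> [_ pX] qX; apply: ge_inf; last by exists q.
  by exists 0 => _ [z [_ zX] <-]; exact: d0.
have or : facet_dist X d v o = r.
  apply/eqP; rewrite eq_le -{1}oq0 dist_le//=; apply: lb_le_inf.
    by exists (d o q0), q0.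
  by move=> _ [q qX <-]; exact: oge.
have pr p : (hull v `&` X) p -> p <> o -> facet_dist X d v p < r.
  by move=> pX po; have [q qX] := plt p pX po; apply: le_lt_trans; exact: dist_le.
split; first by split => // p pX po; rewrite or; exact: pr.
have ub p : (hull v `&` X) p -> facet_dist X d v p <= r.
  by move=> pX; have [->|/eqP po] := eqVneq p o; [rewrite or|exact/ltW/pr].
apply/eqP; rewrite eq_le; apply/andP; split.
  by apply: ge_sup => [|_ [p pX <-]]; [exists r, o|exact: ub].
rewrite -{1}or; apply: ub_le_sup; last by exists o.
by exists r => _ [p pX <-]; exact: ub.
Qed.

End Isometries.

(** * Facet equations of a simplex *)

Section Barycentric.
Context {R : realType} {n : nat}.
Implicit Types (x y z p q : 'rV[R]_n) (v : simplex R n) (k : 'I_n.+1).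
Implicit Types (a t : 'I_n.+1 -> R) (u : 'I_n.+1 -> 'rV[R]_n).

(* The k-th hyperface lies in the hyperplane [dot (u k) x = t k], with outward
   unit normal [u k], and [(a k)^-1] is the height of [v k] above it. *)
Definition barycentric v a t u : Prop :=
  [/\ forall k, 0 < a k, forall k, dot (u k) (u k) = 1,
      forall x, \sum_k a k * (t k - dot (u k) x) = 1,
      forall x, \sum_k (a k * (t k - dot (u k) x)) *: v k = x
    & forall j k, a k * (t k - dot (u k) (v j)) = (j == k)%:R].

(** By affine independence the rows (1, v i) form an invertible matrix. The columns of its inverse
    are the barycentric coordinates [c k - dot (b k) x]; dividing by [enorm (b k)], which becomes
    [a k], normalizes the normals. *)
Lemma barycentric_exists v : (0 < n)%N -> affinely_independent v ->
  exists a t u, barycentric v a t u.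
Proof.
move=> n0 vi.
pose M : 'M[R]_(n.+1, 1 + n) := row_mx (const_mx 1) (\matrix_(i, j) v i 0 j).
have mulM (r : 'rV[R]_n.+1) : r *m M = row_mx (\sum_i r 0 i)%:M (\sum_i r 0 i *: v i).
  rewrite mul_mx_row; congr row_mx; apply/rowP => j.
    by rewrite !ord1 !mxE; apply: eq_bigr => i _; rewrite mxE mulr1.
  by rewrite !mxE summxE; apply: eq_bigr => i _; rewrite !mxE.
have Mu : (M : 'M[R]_(n.+1)) \in unitmx.
  rewrite -row_free_unit; apply/inj_row_free => r.
  move=> rM; have : r *m M = row_mx 0 0 by rewrite row_mx0.
  rewrite mulM => /eq_row_mx[r0 rv].
  have {}r0 : \sum_i r 0 i = 0 by move/rowP : r0 => /(_ 0); rewrite !mxE eqxx.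
  by apply/rowP => i; rewrite mxE (vi _ r0 rv i).
pose N : 'M[R]_(1 + n, n.+1) := invmx (M : 'M[R]_(n.+1)).
pose c k : R := usubmx N 0 k.
pose b k : 'rV[R]_n := - (col k (dsubmx N))^T.
pose l k x : R := c k - dot (b k) x.
have lE x k : l k x = (row_mx 1%:M x *m N) 0 k.
  rewrite -[N]vsubmxK mul_row_col mul1mx mxE /l /c dotNl opprK.
  by congr (_ + _); rewrite [RHS]mxE dotC; apply: eq_bigr => j _; rewrite !mxE.
have lM x : row_mx (\sum_k l k x)%:M (\sum_k l k x *: v k) = row_mx 1%:M x.
  rewrite -[RHS](mulmxKV Mu) mulM; congr (row_mx _%:M _); apply: eq_bigr => k _;
  by rewrite lE.
have l1 x : \sum_k l k x = 1.
  by have /eq_row_mx[/rowP/(_ 0)] := lM x; rewrite !mxE eqxx.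
have lv x : \sum_k l k x *: v k = x by have /eq_row_mx[_] := lM x.
have ld j k : l k (v j) = (j == k)%:R.
  rewrite lE; have -> : row_mx 1%:M (v j) = row j M.
    rewrite row_row_mx; congr row_mx; apply/rowP => i; rewrite !mxE ?ord1 ?eqxx//.
  by rewrite -row_mul (mulmxV Mu) mxE mxE.
(* A zero gradient would make the form constant, yet it is 1 at [v k] and 0 at another vertex, which
   exists since [0 < n]. *)
have b0 k : 0 < enorm (b k).
  rewrite lt0r enorm_ge0 andbT; apply/eqP => b0.
  have bk : b k = 0 by apply: dot_eq0; rewrite -enorm_sqr b0 expr0n.
  have := ld k k; have := ld (lift k (Ordinal n0)) k.
  rewrite eqxx eq_sym (negbTE (neq_lift _ _)) /l bk !dot0l => ->.
  by move/eqP; rewrite eq_sym oner_eq0.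
exists (fun k => enorm (b k)), (fun k => c k / enorm (b k)),
  (fun k => (enorm (b k))^-1 *: b k).
have lF k x : enorm (b k) * (c k / enorm (b k) - dot ((enorm (b k))^-1 *: b k) x) = l k x.
  by rewrite dotZl /l; field; rewrite lt0r_neq0.
split => // [k|x|x|j k]; last by rewrite lF.
- by rewrite dotZl dotZr -enorm_sqr; field; rewrite lt0r_neq0.
- by rewrite -[RHS](l1 x); apply: eq_bigr => k _; exact: lF.
- by rewrite -[RHS](lv x); apply: eq_bigr => k _; rewrite lF.
Qed.

Lemma barycentric_unique v a t u (r : 'I_n.+1 -> R) x k : barycentric v a t u ->
  \sum_i r i = 1 -> x = \sum_i r i *: v i -> a k * (t k - dot (u k) x) = r k.
Proof.
move=> [_ _ _ _ d] r1 ->.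
rewrite (dotC (u k)) dot_suml -[t k]mul1r -r1 mulr_suml -sumrB mulr_sumr.
rewrite (bigD1 k)//= big1 ?addr0 => [|j /negbTE jk].
  by rewrite dotZl -mulrBr mulrCA (dotC (v k)) d eqxx mulr1.
by rewrite dotZl -mulrBr mulrCA (dotC (v j)) d jk mulr0.
Qed.

Lemma hyperfaceP v k x : hyperface v k x <->
  exists r : 'I_n.+1 -> R, [/\ forall i, 0 <= r i, \sum_i r i = 1,
    x = \sum_i r i *: v i & r k = 0].
Proof.
split=> [[r [r0 r1 xE]]|[r [r0 r1 xE rk]]].
  exists (fun i => oapp r 0 (unlift k i)); split.
  - by move=> i; case: unlift => /=.
  - rewrite (bigD1_ord k)//= unlift_none add0r -[RHS]r1.
    by apply: eq_bigr => j _; rewrite liftK.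
  - rewrite (bigD1_ord k)//= unlift_none scale0r add0r xE.
    by apply: eq_bigr => j _; rewrite liftK.
  - by rewrite unlift_none.
exists (r \o lift k); split => [i||]; first exact: r0.
- by move: r1; rewrite (bigD1_ord k)//= rk add0r.
- by rewrite xE (bigD1_ord k)//= rk scale0r add0r.
Qed.

Lemma affine_faceP v k x : affine_span (face_vertices v k) x <->
  exists r : 'I_n.+1 -> R, [/\ \sum_i r i = 1, x = \sum_i r i *: v i & r k = 0].
Proof.
split=> [[r [r1 xE]]|[r [r1 xE rk]]].
  exists (fun i => oapp r 0 (unlift k i)); split.
  - rewrite (bigD1_ord k)//= unlift_none add0r -[RHS]r1.
    by apply: eq_bigr => j _; rewrite liftK.
  - rewrite (bigD1_ord k)//= unlift_none scale0r add0r xE.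
    by apply: eq_bigr => j _; rewrite liftK.
  - by rewrite unlift_none.
exists (r \o lift k); split.
- by move: r1; rewrite (bigD1_ord k)//= rk add0r.
- by rewrite xE (bigD1_ord k)//= rk scale0r add0r.
Qed.

Lemma barycentric_hull v a t u x : barycentric v a t u ->
  hull v x <-> forall k, dot (u k) x <= t k.
Proof.
move=> vb; have [a0 u1 s1 sx _] := vb; split=> [[r [r0 r1 xE]] k|xt].
  by have := r0 k; rewrite -(barycentric_unique k vb r1 xE) pmulr_rge0// subr_ge0.
exists (fun k => a k * (t k - dot (u k) x)); split => // k.
by rewrite pmulr_rge0// subr_ge0.
Qed.

Lemma barycentric_hyperface v a t u k x : barycentric v a t u ->
  hyperface v k x <-> hull v x /\ dot (u k) x = t k.
Proof.
move=> vb; have [a0 u1 s1 sx _] := vb; split=> [/hyperfaceP[r [r0 r1 xE rk]]|].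
  split; first by exists r.
  have := barycentric_unique k vb r1 xE; rewrite rk => /eqP.
  by rewrite mulf_eq0 gt_eqF//= subr_eq0 => /eqP.
move=> [/(barycentric_hull _ vb) xt xk]; apply/hyperfaceP.
exists (fun k => a k * (t k - dot (u k) x)); split => // [j|].
  by rewrite pmulr_rge0// subr_ge0.
by rewrite xk subrr mulr0.
Qed.

Lemma barycentric_affine_face v a t u k x : barycentric v a t u ->
  affine_span (face_vertices v k) x <-> dot (u k) x = t k.
Proof.
move=> vb; have [a0 u1 s1 sx _] := vb; split=> [/affine_faceP[r [r1 xE rk]]|xk].
  have := barycentric_unique k vb r1 xE; rewrite rk => /eqP.
  by rewrite mulf_eq0 gt_eqF//= subr_eq0 => /eqP.
apply/affine_faceP; exists (fun k => a k * (t k - dot (u k) x)); split => //.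
by rewrite xk subrr mulr0.
Qed.

Lemma barycentric_vertex v a t u j k : barycentric v a t u -> j != k ->
  dot (u k) (v j) = t k.
Proof.
move=> [a0 _ _ _ d] jk; have := d j k; rewrite (negbTE jk) => /eqP.
by rewrite mulf_eq0 gt_eqF//= subr_eq0 => /eqP.
Qed.

Lemma sum_delta m (i : 'I_m) : \sum_j (j == i)%:R = 1 :> R.
Proof. by rewrite (bigD1 i)//= eqxx big1 ?addr0// => j /negbTE ->. Qed.

Lemma sum_delta_scale m (w : 'I_m -> 'rV[R]_n) i : \sum_j ((j == i)%:R : R) *: w j = w i.
Proof.
by rewrite (bigD1 i)//= eqxx scale1r big1 ?addr0// => j /negbTE ->; rewrite scale0r.
Qed.

Lemma vertex_hull m (w : 'I_m -> 'rV[R]_n) i : hull w (w i).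
Proof.
exists (fun j => (j == i)%:R); rewrite sum_delta sum_delta_scale.
by split => // j; exact: ler0n.
Qed.

Lemma vertex_hyperface v a t u j k : barycentric v a t u -> j != k ->
  hyperface v k (v j).
Proof.
move=> vb jk; apply/(barycentric_hyperface _ _ vb).
by split; [exact: vertex_hull|exact: barycentric_vertex vb jk].
Qed.

(** The tool for recognizing facet normals: [s - dot y x] vanishes at all vertices of the k-th face,
    hence is a multiple of the k-th facet form. The factor [r] is read off at [v k], and [x = 0]
    gives the offset. *)
Lemma barycentric_normal v a t u k y (s : R) : barycentric v a t u ->
  (forall j, j != k -> dot y (v j) = s) ->
  exists2 r, y = r *: u k & s = r * t k.
Proof.
move=> [a0 u1 s1 sx d] ys; pose r := a k * (s - dot y (v k)).
have yx x : dot y x = s - r * (t k - dot (u k) x).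
  rewrite -{1}(sx x) dotC dot_suml -[s]mul1r -[in RHS](s1 x) mulr_suml.
  rewrite (bigD1 k)//= [in RHS](bigD1 k)//=; under eq_bigr => j jk.
    by rewrite dotZl (dotC _ y) ys//; over.
  by rewrite dotZl (dotC _ y) /r; ring.
have s0 : s = r * t k by have := yx 0; rewrite !dotE subr0 => /eqP; rewrite eq_sym subr_eq0 => /eqP.
by exists r => //; apply: dot_ext => x; rewrite yx dotZl s0; ring.
Qed.

(** A unit vector orthogonal to the face is [u k] up to sign, and the sign is decided by the outward
    condition at [v k]. *)
Lemma outward_normalE v a t u k : (0 < n)%N -> barycentric v a t u ->
  outward_normal v k = u k.
Proof.
move=> n0 vb; have [a0 u1 s1 sx d] := vb.
pose j0 := lift k (Ordinal n0); have j0k : j0 != k by rewrite eq_sym neq_lift.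
have vk j : j != k -> a k * dot (u k) (v k - v j) = -1.
  move=> jk; have := d k k; have := barycentric_vertex vb jk; rewrite eqxx !dotE => -> h.
  by rewrite -[in RHS](h : _ = 1); ring.
apply: get_unique.
  split; first by rewrite /enorm u1 sqrtr1.
    move=> x y /(barycentric_hyperface _ _ vb)[_ ex] /(barycentric_hyperface _ _ vb)[_ ey].
    by rewrite !dotE ex ey subrr.
  move=> x /(barycentric_hyperface _ _ vb)[_ ex].
  rewrite -(pmulr_rlt0 _ (a0 k)) dotDr dotNr ex -(barycentric_vertex vb j0k).
  by rewrite -dotNr -dotDr vk//; lra.
move=> y [y1 yf yneg].
have ys j : j != k -> dot y (v j) = dot y (v j0).
  move=> jk; apply/eqP; rewrite -subr_eq0 -dotNr -dotDr; apply/eqP.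
  by apply: yf; exact: vertex_hyperface vb _.
have [r yE _] := barycentric_normal vb ys.
have r1 : r ^+ 2 = 1.
  have : dot y y = 1 by rewrite -enorm_sqr y1 expr1n.
  by rewrite yE !dotE u1 mulr1 expr2.
have r0 : 0 < r.
  have := yneg _ (vertex_hyperface vb j0k); rewrite yE dotZl -(pmulr_rlt0 _ (a0 k)).
  by rewrite mulrCA vk// mulrN1 oppr_lt0.
move/eqP : r1; rewrite sqrf_eq1 => /orP[]/eqP r1; first by rewrite yE r1 scale1r.
by move: r0; rewrite r1 ltr0N1.
Qed.

End Barycentric.

(** * Incenters of simplices *)

Section Incenters.
Context {R : realType} {n : nat}.
Implicit Types (x y z o p q : 'rV[R]_n) (v w : simplex R n) (k : 'I_n.+1).
Implicit Types (a t : 'I_n.+1 -> R) (u : 'I_n.+1 -> 'rV[R]_n).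

Lemma argmin_exists (F : 'I_n.+1 -> R) : exists k, forall j, F k <= F j.
Proof. by case: (arg_minP F (erefl true : xpredT (ord0 : 'I_n.+1))) => k _ h; exists k => j; exact: h. Qed.

Lemma eucl_dist_shift p (c : R) (e : 'rV[R]_n) : dot e e = 1 -> eucl_dist p (p + c *: e) = `|c|.
Proof.
move=> e1; rewrite /eucl_dist opprD addrA subrr sub0r /enorm -sqrtr_sqr.
by congr Num.sqrt; rewrite !dotE e1; ring.
Qed.

(** Moving from [p] to the nearest hyperplane by its distance shortens the distance to any other
    hyperplane by at most as much, because [dot (u j) (u k) <= 1]; so the foot stays in the
    simplex. *)
Lemma euclidean_foot v a t u p k : barycentric v a t u -> hull v p ->
  (forall j, t k - dot (u k) p <= t j - dot (u j) p) ->
  hyperface v k (p + (t k - dot (u k) p) *: u k) /\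
  eucl_dist p (p + (t k - dot (u k) p) *: u k) = t k - dot (u k) p.
Proof.
move=> vb vp min; have [a0 u1 _ _ _] := vb.
have h0 : 0 <= t k - dot (u k) p by rewrite subr_ge0; move/(barycentric_hull _ vb) : vp; apply.
split; last first.
  by rewrite eucl_dist_shift// ger0_norm.
apply/(barycentric_hyperface _ _ vb); split; last by rewrite !dotE u1; ring.
apply/(barycentric_hull _ vb) => j; rewrite !dotE.
have le := ler_piMr h0 (dot_unit_le1 (u1 j) (u1 k)).
by rewrite (le_trans (lerD (lexx _) le))// -lerBrDl min.
Qed.

(** The distances to the hyperplanes, weighted by the inverse heights [a k], add up to 1. Hence the
    smallest is at most the inverse of the sum of the [a j], with equality only when all distances
    agree, and that determines the barycentric coordinates. *)
Lemma euclidean_incenter v a t u : barycentric v a t u ->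
  is_incenter setT eucl_dist v (\sum_k (a k / \sum_j a j) *: v k) /\
  inradius setT eucl_dist v = (\sum_j a j)^-1.
Proof.
move=> vb; have [a0 u1 s1 sx _] := vb; set S := \sum_j a j.
have S0 : 0 < S by rewrite /S (bigD1 ord0)//= ltr_pwDl ?a0// sumr_ge0// => i _; apply/ltW.
have aS : \sum_k (a k / S) = 1 by rewrite -mulr_suml divff// gt_eqF.
set z := \sum_k _.
have lz k : t k - dot (u k) z = S^-1.
  have := barycentric_unique k vb aS erefl; rewrite -/z => /(mulfI (lt0r_neq0 (a0 k))).
  exact.
have zv : hull v z.
  by exists (fun k => a k / S); split => // k; rewrite divr_ge0 ?(ltW (a0 _))// ltW.
apply: incenter_by_dist; rewrite ?setIT//.
- by move=> *; exact: enorm_ge0.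
- move=> q [k _ /(barycentric_hyperface _ _ vb)[_ qk]].
  rewrite -(lz k) -qk -dotNr -dotDr (le_trans (dot_le_enorm _ _))//.
  rewrite {1}/enorm u1 sqrtr1 mul1r /eucl_dist -(opprB q z).
  by rewrite /enorm dotNl dotNr opprK.
- have [|fk fd] := euclidean_foot (k := ord0) vb zv; first by move=> j; rewrite !lz.
  by eexists; [exists ord0 => //; exact: fk|rewrite fd lz].
- move=> p vp pz; have [k min] := argmin_exists (fun k => t k - dot (u k) p).
  have [fk fd] := euclidean_foot vb vp min.
  eexists; [by exists k => //; exact: fk|rewrite fd ltNge; apply/negP => Sk].
  apply: pz; rewrite -(sx p); apply: eq_bigr => j _; congr (_ *: _).
  have pos i : 0 <= a i * (t i - dot (u i) p - S^-1).
    by rewrite mulr_ge0 ?(ltW (a0 _))// subr_ge0 (le_trans Sk).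
  have : \sum_i a i * (t i - dot (u i) p - S^-1) = 0.
    under eq_bigr do rewrite mulrBr.
    by rewrite sumrB s1 aS subrr.
  move/eqP; rewrite psumr_eq0// => /allP/(_ j (mem_index_enum j)).
  by rewrite /= mulrBr subr_eq0 => /eqP.
Qed.

(** For [n >= 2] a hyperface has two distinct vertices; their midpoint lies in the open ball by
    strict convexity, so the hyperplane meets hyperbolic space even when the vertices are ideal. *)
Lemma hyperplane_offset_lt1 v a t u k : (2 <= n)%N -> (forall i, hcball (v i)) ->
  barycentric v a t u -> t k ^+ 2 < 1.
Proof.
move=> n2 vc vb; have [a0 u1 _ _ d] := vb.
have [i [j [ik jk ij]]] : exists i j : 'I_n.+1, [/\ i != k, j != k & i != j].
  exists (lift k (Ordinal (ltnW n2))), (lift k (Ordinal n2)).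
  by rewrite !(eq_sym _ k) !neq_lift (inj_eq (@lift_inj _ k)).
have vij : v i - v j <> 0.
  move/eqP; rewrite subr_eq0 => /eqP e; have := d i i; have := d j i.
  by rewrite e eqxx eq_sym (negbTE ij) => -> /eqP; rewrite eq_sym oner_eq0.
pose z := 2^-1 *: (v i + v j).
have uz : dot (u k) z = t k.
  by rewrite !dotE !(barycentric_vertex vb)//; field.
have := cauchy_schwarz (u k) z; rewrite uz u1 mul1r => /le_lt_trans; apply.
have := dot_gt0 vij; rewrite !dotE (dotC (v j)).
by have /hcballP := vc i; have /hcballP := vc j; lra.
Qed.

(** The hyperplane has Lorentz normal (t, u), of square norm [1 - t ^+ 2] up to sign. The Lorentz
    projection of (1, x) along it is (1 + l t, x + l u), and [q] is that vector in the projective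
    chart. The fourth clause is perpendicularity at [q], the last is cosh^2 = 1 + sinh^2 for the
    distance to the hyperplane. *)
Lemma hyperbolic_foot (u x : 'rV[R]_n) (t : R) : dot u u = 1 -> t ^+ 2 < 1 -> hball x ->
  let l := (t - dot u x) / (1 - t ^+ 2) in
  let q := (1 + l * t)^-1 *: (x + l *: u) in
  [/\ 0 < 1 + l * t, hball q, dot u q = t,
      forall y, dot u y = t ->
        (1 - dot y x) * (1 - dot q q) = (1 - dot y q) * (1 - dot x q)
    & ((1 - dot x q) / Num.sqrt ((1 - dot x x) * (1 - dot q q))) ^+ 2
        = 1 + (t - dot u x) ^+ 2 / ((1 - t ^+ 2) * (1 - dot x x))].
Proof.
move=> u1 t1 xb l q; have x1 : 0 < 1 - dot x x by move/hballP : xb; lra.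
have T0 : 0 < 1 - t ^+ 2 by lra.
have TN : 1 - t ^+ 2 != 0 by lra.
have xN : 1 - dot x x != 0 by lra.
set c := dot u x in l q *.
have lc : l * (1 - t ^+ 2) = t - c by rewrite divfK.
have c1 : c ^+ 2 < 1.
  apply: le_lt_trans (cauchy_schwarz u x) _; rewrite u1 mul1r; lra.
have D0 : 0 < 1 + l * t.
  have -> : 1 + l * t = (1 - t * c) / (1 - t ^+ 2) by rewrite /l; field.
  by rewrite divr_gt0//; have := sqr_ge0 (t - c); nra.
have DN : 1 + l * t != 0 by lra.
have T : 0 < 1 - dot x x + l * (t - c).
  by rewrite -lc mulrA -expr2 ltr_wpDr// mulr_ge0 ?sqr_ge0 ?ltW.
have uq : dot u q = t.
  apply: (mulfI DN); rewrite !dotE u1 -/c mulrA mulfV// mul1r mulr1.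
  by move: lc; lra.
have qq : 1 - dot q q = (1 - dot x x + l * (t - c)) / (1 + l * t) ^+ 2.
  apply: (mulIf (expf_neq0 2 DN)); rewrite divfK ?expf_neq0//.
  rewrite /q !dotE u1 (dotC x u) -/c -[in RHS]lc.
  have -> : c = t - l * (1 - t ^+ 2) by rewrite lc; ring.
  by field.
have xq : 1 - dot x q = (1 - dot x x + l * (t - c)) / (1 + l * t).
  apply: (mulIf DN); rewrite divfK//.
  by rewrite /q !dotE (dotC x u) -/c; field.
have qb : hball q.
  by apply/hballP; rewrite -subr_gt0 qq divr_gt0// exprn_gt0.
split => // [y uy|].
  rewrite qq xq.
  have -> : 1 - dot y q = (1 - dot y x) / (1 + l * t).
    by apply: (mulIf DN); rewrite divfK// /q !dotE (dotC y u) uy; field.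
  by field.
rewrite qq xq expr_div_n sqr_sqrtr; last by rewrite mulr_ge0 ?divr_ge0 ?exprn_ge0 ?ltW.
have -> : (t - c) ^+ 2 / ((1 - t ^+ 2) * (1 - dot x x)) = l * (t - c) / (1 - dot x x).
  by rewrite /l; field; rewrite xN TN.
by field; rewrite xN DN /= lt0r_neq0.
Qed.

(** With equal offsets, sinh of the distance from [p] to a hyperplane is its Euclidean slack
    [tau - dot (u k) p] times a factor depending on [p] only, so the nearest hyperplane is the same
    in both geometries. At 0 the bound is Cauchy-Schwarz, attained at [tau *: u k]. *)
Lemma balanced_hincenter w tau a u : (2 <= n)%N -> (forall i, hcball (w i)) ->
  0 < tau -> barycentric w a (fun=> tau) u ->
  is_incenter hball hdist w 0 /\ hinradius w = arcosh (Num.sqrt (1 - tau ^+ 2))^-1.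
Proof.
move=> n2 wc tau0 wb; have [a0 u1 _ _ _] := wb.
have tau2 := hyperplane_offset_lt1 ord0 n2 wc wb.
have w0 : hull w 0 by apply/(barycentric_hull _ wb) => k; rewrite dot0r ltW.
have s0 : 0 < Num.sqrt (1 - tau ^+ 2) by rewrite sqrtr_gt0; lra.
have s1 : 1 <= (Num.sqrt (1 - tau ^+ 2))^-1.
  by rewrite invf_ge1// -[leRHS]sqrtr1 ler_wsqrtr// gerBl sqr_ge0.
apply: incenter_by_dist.
- exact: hdist_ge0.
- by split => //; exact: hball0.
- move=> q [[k _ /(barycentric_hyperface _ _ wb)[_ qk]] qb]; rewrite hdist0E.
  have := cauchy_schwarz (u k) q; rewrite u1 mul1r qk => tq.
  have q1 : dot q q < 1 by apply/hballP.
  apply: arcosh_ler => //; rewrite lef_pV2 ?posrE ?sqrtr_gt0//; try lra.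
  by rewrite ler_wsqrtr//; lra.
- exists (tau *: u ord0).
    split; last by apply/hballP; rewrite !dotE u1 mulr1 -expr2.
    exists ord0 => //; apply/(barycentric_hyperface _ _ wb); split.
      apply/(barycentric_hull _ wb) => j; rewrite dotZr ler_piMr ?(ltW tau0)//.
      exact: dot_unit_le1.
    by rewrite dotZr u1 mulr1.
  by rewrite hdist0E !dotE u1 mulr1 -expr2.
move=> p [wp pb] pN0; have [k min] := argmin_exists (fun k => tau - dot (u k) p).
have p1 : dot p p < 1 by apply/hballP.
have pp0 := dot_gt0 pN0.
have kp : dot (u k) p <= tau by move/(barycentric_hull _ wb) : wp; apply.
have [] := hyperbolic_foot (u1 k) tau2 pb.
set l := _ / _; set q := _ *: _ => D0 qb uq _ dq.
have l0 : 0 <= l by rewrite divr_ge0// subr_ge0// ltW.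
(* The foot on the nearest hyperplane stays in the simplex: after clearing [1 + l * tau] the
   inequality for j is the comparison of the slacks of k and j. *)
have qw : hull w q.
  apply/(barycentric_hull _ wb) => j; rewrite /q dotZr mulrC ler_pdivrMr// !dotE.
  have ljk := ler_wpM2l l0 (dot_unit_le1 (u1 j) (u1 k)).
  have lE : l * (1 - tau ^+ 2) = tau - dot (u k) p by rewrite divfK//; lra.
  have := min j; lra.
exists q; first by split=> //; exists k => //; apply/(barycentric_hyperface _ _ wb).
apply: arcosh_ltr; first exact: hdist_arg_ge1.
have A1 := hdist_arg_ge1 pb qb.
rewrite -(@ltr_pXn2r _ 2)// ?nnegrE; try lra.
rewrite dq exprVn sqr_sqrtr; last by lra.
suff lt : (tau - dot (u k) p) ^+ 2 < tau ^+ 2 * (1 - dot p p).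
  have -> : (1 - tau ^+ 2)^-1 = 1 + tau ^+ 2 / (1 - tau ^+ 2) by field; lra.
  rewrite ltrD2l (mulrC (1 - _)) invfM mulrA ltr_pM2r ?invr_gt0; last by lra.
  by rewrite ltr_pdivrMr//; lra.
(* If every slack were at least [tau * s], then [(1 - s)^-1 *: p] would still lie in the simplex,
   hence in the closed ball; but [dot p p = (1 - s) (1 + s)] exceeds [(1 - s) ^+ 2]. *)
pose s := Num.sqrt (1 - dot p p).
have ss : s ^+ 2 = 1 - dot p p by rewrite sqr_sqrtr//; lra.
have sp : 0 < s by rewrite sqrtr_gt0; lra.
have sl1 : s < 1 by rewrite -(@ltr_pXn2r _ 2)// ?nnegrE ?ler01 ?ltW// ss expr1n; lra.
rewrite -ss -exprMn ltr_pXn2r ?nnegrE ?subr_ge0//; last by rewrite mulr_ge0 ?ltW.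
rewrite ltNge; apply/negP => le.
have pw : hull w ((1 - s)^-1 *: p).
  apply/(barycentric_hull _ wb) => j; rewrite dotZr mulrC ler_pdivrMr ?subr_gt0//.
  by have := min j; move: le; lra.
have /hcballP := hull_hcball wc pw; rewrite !dotE => h.
have : dot p p <= (1 - s) ^+ 2.
  rewrite -[leRHS]mulr1 -ler_pdivrMl ?exprn_gt0 ?subr_gt0//.
  by apply: le_trans h; rewrite mulrA -invfM -expr2.
have -> : dot p p = 1 - s ^+ 2 by rewrite ss; ring.
by nra.
Qed.

End Incenters.

(** * Moving the incenter to the origin *)

Section Incentring.
Context {R : realType} {n : nat} (n2 : (2 <= n)%N).
Implicit Types (x y z o p q : 'rV[R]_n) (g h : 'rV[R]_n -> 'rV[R]_n) (v w : simplex R n) (k : 'I_n.+1).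
Implicit Types (a t : 'I_n.+1 -> R) (u : 'I_n.+1 -> 'rV[R]_n).

(** If [o] were on the sphere, the nonnegative numbers [1 - dot (v k) o] would average to 0 with
    positive weights, and every vertex would coincide with [o]. *)
Lemma barycentric_hball v a t u (r : 'I_n.+1 -> R) :
  (forall i, hcball (v i)) -> barycentric v a t u ->
  (forall k, 0 < r k) -> \sum_k r k = 1 -> hball (\sum_k r k *: v k).
Proof.
move=> vc [a0 u1 _ _ d] r0 r1; set o := \sum_k _.
have oc : hcball o by apply: (hull_hcball vc); exists r; split => // k; exact: ltW.
apply/hballP; rewrite lt_neqAle; apply/andP; split; last exact/hcballP.
apply/eqP => o1.
have le1 k : dot (v k) o <= 1.
  by rewrite (le_trans (dot_le_enorm _ _))// mulr_ile1 ?enorm_ge0//; exact: vc.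
have s0 : \sum_k r k * (1 - dot (v k) o) = 0.
  under eq_bigr do rewrite mulrBr mulr1 -dotZl.
  by rewrite sumrB r1 -dot_suml o1 subrr.
have vo k : v k = o.
  have rk i : 0 <= r i * (1 - dot (v i) o) by rewrite mulr_ge0 ?(ltW (r0 _))// subr_ge0.
  have /eqP := s0; rewrite psumr_eq0// => /allP/(_ k (mem_index_enum k))/=.
  rewrite mulf_eq0 gt_eqF//= subr_eq0 => /eqP vk.
  apply/eqP; rewrite -subr_eq0; apply/eqP/dot_eq0/eqP; rewrite eq_le dot_ge0 andbT.
  by rewrite !dotE (dotC o (v k)) -vk o1; have /hcballP := vc k; lra.
have := d (lift ord0 (Ordinal n2)) ord0; have := d ord0 ord0.
by rewrite !vo eqxx eq_sym (negbTE (neq_lift _ _)) => -> /eqP; rewrite oner_eq0.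
Qed.

(* [(1 - dot x p) (1 - dot q q) = (1 - dot x q) (1 - dot p q)] says that the
   geodesics from q to x and to p are orthogonal at q. *)
Lemma isom_perp g x p q : is_isom g -> hcball x -> hcball p -> hcball q ->
  (1 - dot x p) * (1 - dot q q) = (1 - dot x q) * (1 - dot p q) ->
  (1 - dot (g x) (g p)) * (1 - dot (g q) (g q))
    = (1 - dot (g x) (g q)) * (1 - dot (g p) (g q)).
Proof.
move=> /isom_moebius[[m [mp conf _ _]] _] xc pc qc e; rewrite !conf//.
by rewrite mulrACA e [RHS]mulrACA -!invfM; congr (_ * _^-1); ring.
Qed.

Lemma incentre_exists v : total_simplex v -> exists2 o, hball o &
  forall g, is_isom g -> g o = 0 ->
    exists tau a u, 0 < tau /\ barycentric (g \o v) a (fun=> tau) u.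
Proof.
move=> [vc vi]; have n0 := ltnW n2.
have [a [t [u vb]]] := barycentric_exists n0 vi; have [a0 u1 _ _ d] := vb.
have t1 k : t k ^+ 2 < 1 by exact: hyperplane_offset_lt1 n2 vc vb.
pose c k := Num.sqrt (1 - t k ^+ 2).
have c0 k : 0 < c k by rewrite sqrtr_gt0; have := t1 k; lra.
have c2 k : c k ^+ 2 = 1 - t k ^+ 2 by rewrite sqr_sqrtr//; have := t1 k; lra.
pose S := \sum_j a j * c j.
have S0 : 0 < S.
  rewrite /S (bigD1 ord0)//= ltr_pwDl ?mulr_gt0// sumr_ge0// => i _.
  by rewrite mulr_ge0 ?ltW.
(* [c k] is the Lorentz norm of the normal (t k, u k). Equality of the normalized forms at [o] means
   that [t k - dot (u k) o] is proportional to [c k]; multiplying by [a k] gives the barycentric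
   coordinates. *)
pose r k := a k * c k / S.
have r0 k : 0 < r k by rewrite divr_gt0 ?mulr_gt0.
have r1 : \sum_k r k = 1 by rewrite -mulr_suml divff// gt_eqF.
pose o := \sum_k r k *: v k.
have ob : hball o by exact: barycentric_hball vc vb r0 r1.
have oc := hball_hcball ob.
have lo k : t k - dot (u k) o = c k / S.
  apply: (mulfI (lt0r_neq0 (a0 k))).
  by rewrite (barycentric_unique k vb r1 erefl) /r mulrA.
exists o => // g gi go.
have gc i : hcball ((g \o v) i) by exact: isom_hcball.
have [a' [t' [u' wb]]] := barycentric_exists n0 (isom_affinely_independent gi vc vi).
have [a0' u1' _ _ _] := wb.
have o1 : 0 < 1 - dot o o by move/hballP : ob; lra.
(* [K] is sinh^2 of the common distance from [o] to the hyperplanes, so [K / (1 + K)] is tanh^2. *)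
pose K := (S ^+ 2 * (1 - dot o o))^-1.
have K0 : 0 < K by rewrite invr_gt0 mulr_gt0// exprn_gt0.
pose tau := Num.sqrt (K / (1 + K)).
have KK : 0 < K / (1 + K) by rewrite divr_gt0// addr_gt0.
have tau0 : 0 < tau by rewrite sqrtr_gt0.
have tau2 : tau ^+ 2 = K / (1 + K) by rewrite sqr_sqrtr// ltW.
exists tau, a', u'; split => //.
suff <- : t' = (fun=> tau) by [].
apply/funext => k.
have [] := hyperbolic_foot (u1 k) (t1 k) ob.
set q := _ *: _ => _ qb uq perp dq; have qc := hball_hcball qb.
have yb := isom_hball gi qb; have y1 : 0 < 1 - dot (g q) (g q) by move/hballP : yb; lra.
have yy : dot (g q) (g q) = tau ^+ 2.
  have e : hdist 0 (g q) = hdist o q by rewrite -go; case: gi => _ gd _; exact: gd.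
  have := arcosh_inj (hdist_arg_ge1 (@hball0 _ _) yb) (hdist_arg_ge1 ob qb) e.
  move/(congr1 (fun s => s ^+ 2)); rewrite dq lo !dot0l subr0 !mul1r exprVn.
  rewrite sqr_sqrtr ?(ltW y1)// expr_div_n c2.
  have tN : 1 - t k ^+ 2 != 0 by have := t1 k; lra.
  have -> : (1 - t k ^+ 2) / S ^+ 2 / ((1 - t k ^+ 2) * (1 - dot o o)) = K.
    by rewrite /K; field; rewrite tN !lt0r_neq0.
  move=> /(congr1 (@GRing.inv R)); rewrite invrK => yK.
  by rewrite tau2 -[LHS](subKr 1) yK; field; lra.
(* The perpendicular from [o] becomes a perpendicular from 0, where the Lorentz condition reduces to
   Euclidean orthogonality of [g q] to the image facet. *)
have yv j : j != k -> dot (g q) ((g \o v) j) = tau ^+ 2.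
  move=> jk; have := isom_perp gi (vc j) oc qc (perp _ (barycentric_vertex vb jk)).
  rewrite go dot0r dot0l subr0 mul1r mulr1 => /addrI/oppr_inj e.
  by rewrite dotC /= -e yy.
have [s yE ts] := barycentric_normal wb yv.
have s2 : s ^+ 2 = tau ^+ 2 by rewrite -yy yE !dotE u1' mulr1 expr2.
have sN0 : s != 0 by rewrite -sqrf_eq0 s2 sqrf_eq0 gt_eqF.
have st : s = t' k by apply: (mulfI sN0); rewrite -ts -s2.
(* Only the sign of [t' k] is open. The barycentric coordinates [a' k * t' k] of 0 are those of [o]
   times positive multipliers, hence positive. *)
move: s2; rewrite st => /eqP; rewrite eqf_sqr => /orP[/eqP//|/eqP tneg].
have [[m M] _] := isom_moebius gi.
have [w1 wE] := moebius_weights M vc oc r1 erefl.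
have := barycentric_unique k wb w1 wE; rewrite go dot0r subr0 => tk.
have : 0 < a' k * t' k.
  case: M => mp _ _ _; rewrite tk.
  by apply: divr_gt0; [apply: mulr_gt0; [exact: r0|exact/mp/vc]|exact: mp].
by rewrite pmulr_rgt0 ?a0'// tneg oppr_gt0 => /(lt_trans tau0); rewrite ltxx.
Qed.

Lemma hincenterP v : total_simplex v -> is_incenter hball hdist v (hincenter v).
Proof.
move=> vT; have [vc _] := vT; have [c cb cg] := incentre_exists vT.
have bi := isom_boost cb.
have [tau [a [u [tau0 wb]]]] := cg _ bi (boost_self cb).
have wc i : hcball ((boost c \o v) i) by exact: isom_hcball.
have [w0 _] := balanced_hincenter n2 wc tau0 wb.
suff vc' : is_incenter hball hdist v c by rewrite (hincenterE vc').
have [g' [gi' g'g gg']] := isom_inverse bi.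
have := isom_incenter gi' wc w0.
rewrite -(boost_self cb) g'g; last exact: hball_hcball.
by congr is_incenter; apply/funext => i /=; rewrite g'g.
Qed.

Lemma hincenter_hball v : total_simplex v -> hball (hincenter v).
Proof. by case/hincenterP => -[]. Qed.

Lemma isom_hincenter g v : is_isom g -> total_simplex v ->
  hincenter (g \o v) = g (hincenter v).
Proof.
move=> gi vT; apply/hincenterE/isom_incenter => //; last exact: hincenterP.
by case: vT.
Qed.

Lemma incentred_barycentric g v : total_simplex v -> is_isom g -> g (hincenter v) = 0 ->
  exists tau a u, [/\ 0 < tau, tau < 1, barycentric (g \o v) a (fun=> tau) u
    & tanh (hinradius v) = tau].
Proof.
move=> vT gi g0; have [vc _] := vT; have [c cb cg] := incentre_exists vT.
have gT := isom_total gi vT; have [gc _] := gT.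
(* The boost centred at [c] balances the simplex, so it takes the incenter to 0, as it does [c]; it
   is injective on the ball. *)
suff cE : hincenter v = c.
  rewrite cE in g0; have [tau [a [u [tau0 wb]]]] := cg g gi g0.
  have tau1 : tau < 1.
    rewrite -(@ltr_pXn2r _ 2)// ?nnegrE ?ler01 ?(ltW tau0)// expr1n.
    exact: hyperplane_offset_lt1 ord0 n2 gc wb.
  exists tau, a, u; split => //.
  have [_] := balanced_hincenter n2 gc tau0 wb.
  by rewrite isom_hinradius// => ->; rewrite tanh_arcosh// ltW.
have bi := isom_boost cb.
have [tau [a [u [tau0 wb]]]] := cg _ bi (boost_self cb).
have wc i : hcball ((boost c \o v) i) by exact: isom_hcball.
have [/hincenterE w0 _] := balanced_hincenter n2 wc tau0 wb.
rewrite isom_hincenter// in w0; rewrite -(boostK cb (hball_hcball (hincenter_hball vT))) w0.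
by rewrite -(boost_self cb) boostK//; exact: hball_hcball.
Qed.

End Incentring.

(** * Stabilizers permute the vertices *)

Section Vertices.
Context {R : realType} {n : nat}.
Implicit Types (v w : simplex R n).

Lemma affinely_independent_inj m (w : 'I_m -> 'rV[R]_n) :
  affinely_independent w -> injective w.
Proof.
move=> wi i j wij; apply/eqP/negPn/negP => ij.
pose r l : R := (l == i)%:R - (l == j)%:R.
have r0 : \sum_l r l = 0 by rewrite sumrB !sum_delta subrr.
have rw : \sum_l r l *: w l = 0.
  by under eq_bigr do rewrite scalerBl; rewrite sumrB !sum_delta_scale wij subrr.
by have := wi r r0 rw i; rewrite /r eqxx (negbTE ij) subr0 => /eqP; rewrite oner_eq0.
Qed.

(* Writing each family as convex combinations of the other gives nonnegative
   matrices with product the identity; such a product forces each w i to be a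
   single v j. *)
Lemma hull_eq_vertex m (v w : 'I_m -> 'rV[R]_n) i : affinely_independent w ->
  hull w = hull v -> exists j, w i = v j.
Proof.
move=> wi hwv.
have [a [a0 a1 wE]] : hull v (w i) by rewrite -hwv; exact: vertex_hull.
have /choice[b bP] : forall j, exists b : 'I_m -> R,
    [/\ forall k, 0 <= b k, \sum_k b k = 1 & v j = \sum_k b k *: w k].
  by move=> j; have : hull w (v j) by rewrite hwv; exact: vertex_hull.
have [j aj] : exists j, 0 < a j.
  apply/not_existsP => aN; have : \sum_j a j <= 0.
    by apply: sumr_le0 => j _; rewrite leNgt; apply/negP/aN.
  by rewrite a1 ler10.
pose r k := \sum_j a j * b j k.
have rE k : r k = (k == i)%:R.
  apply/eqP; rewrite -subr_eq0; apply/eqP.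
  apply: (wi (fun k => r k - (k == i)%:R)).
    rewrite sumrB sum_delta exchange_big/=.
    under eq_bigr => l _ do rewrite -mulr_sumr (let: And3 _ s _ := bP l in s) mulr1.
    by rewrite a1 subrr.
  under eq_bigr do rewrite scalerBl; rewrite sumrB sum_delta_scale.
  apply/eqP; rewrite subr_eq0; apply/eqP; rewrite [RHS]wE.
  under eq_bigr do rewrite scaler_suml.
  rewrite exchange_big/=; apply: eq_bigr => l _.
  rewrite [in RHS](let: And3 _ _ e := bP l in e) scaler_sumr.
  by apply: eq_bigr => k0 _; rewrite scalerA.
exists j; have [b0 b1 vE] := bP j.
have bk k : k != i -> b j k = 0.
  move=> /negbTE ki; have := rE k; rewrite ki => /eqP.
  rewrite psumr_eq0 => [/allP/(_ j (mem_index_enum j))/=|l _]; last first.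
    by rewrite mulr_ge0//; have [] := bP l.
  by rewrite mulf_eq0 gt_eqF//= => /eqP.
rewrite vE (bigD1 i)//= big1 ?addr0 => [|k ki]; last by rewrite bk// scale0r.
suff -> : b j i = 1 by rewrite scale1r.
by move: b1; rewrite (bigD1 i)//= big1 ?addr0// => k ki; rewrite bk.
Qed.

(** An injection between index sets of the same size is a permutation, and a permutation of the
    vertices merely relabels the faces. Incenters thus depend on the set of vertices only. *)
Lemma hull_facets_permuted v w : injective w -> (forall i, exists j, w i = v j) ->
  hull w = hull v /\ facets w = facets v.
Proof.
move=> winj /choice[s sE]; have sinj : injective s.
  by move=> i j sij; apply: winj; rewrite !sE sij.
have [s' ss' s's] := injF_bij sinj.
have vE i : v i = w (s' i) by rewrite sE s's.
have sub (x y : simplex R n) (f f' : 'I_n.+1 -> 'I_n.+1) :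
    cancel f f' -> cancel f' f -> (forall i, x i = y (f i)) ->
    hull x `<=` hull y /\ facets x `<=` facets y.
  move=> ff' f'f xE; have bf : {on predT, bijective f} by exists f' => i _.
  have sum1 r : \sum_i r (f' i) = \sum_i r i :> R.
    by rewrite (reindex f)//; apply: eq_bigr => i _; rewrite ff'.
  have sumx r : \sum_i r (f' i) *: y i = \sum_i (r i : R) *: x i.
    by rewrite (reindex f)//; apply: eq_bigr => i _; rewrite ff' xE.
  split=> z.
    by move=> [r [r0 r1 zE]]; exists (r \o f'); rewrite sum1 sumx; split => // i; exact: r0.
  move=> [k _ /hyperfaceP[r [r0 r1 zE rk]]]; exists (f k) => //; apply/hyperfaceP.
  exists (r \o f'); rewrite sum1 sumx; split => //; first by move=> i; exact: r0.
  by rewrite /= ff'.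
have [h1 f1] := sub _ _ _ _ ss' s's sE.
have [h2 f2] := sub _ _ _ _ s's ss' vE.
by split; apply/seteqP.
Qed.

Lemma incenter_congr X d v w o : hull w = hull v -> facets w = facets v ->
  is_incenter X d v o -> is_incenter X d w o.
Proof. by move=> hE fE; rewrite /is_incenter /facet_dist hE fE. Qed.

Lemma stabilizer_vertices v h : total_simplex v -> hull_stabilizer v h ->
  range (h \o v) = range v.
Proof.
move=> vT [hi hv]; have [vc vi] := vT; have [wc wi] := isom_total hi vT.
have hE : hull (h \o v) = hull v by rewrite isom_hull.
apply/seteqP; split => _ [i _ <-].
  by have [j ->] := hull_eq_vertex i wi hE; exists j.
by have [j ->] := hull_eq_vertex i vi (esym hE); exists j.
Qed.

Lemma range_stabilizer v h : total_simplex v -> is_isom h ->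
  range (h \o v) = range v -> hull_stabilizer v h.
Proof.
move=> vT hi hv; have [vc _] := vT; have [_ wi] := isom_total hi vT.
split => //; rewrite -isom_hull//.
apply: (proj1 (hull_facets_permuted (affinely_independent_inj wi) _)) => i.
have [j _ <-] : range v ((h \o v) i) by rewrite -hv; exists i.
by exists j.
Qed.

(** [h \o v] is a relabelling of [v], so both have the same incenter, while incenters are
    equivariant under [h]. *)
Lemma stabilizer_incenter v h : (2 <= n)%N -> total_simplex v -> hull_stabilizer v h ->
  h (hincenter v) = hincenter v.
Proof.
move=> n2 vT hs; have hi : is_isom h by case: hs.
have [wc wi] := isom_total hi vT.
rewrite -isom_hincenter//; apply: hincenterE.
have [i|hE fE] := hull_facets_permuted (v := v) (affinely_independent_inj wi).
  have [j _ <-] : range v ((h \o v) i) by rewrite -(stabilizer_vertices vT hs); exists i.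
  by exists j.
exact: incenter_congr hE fE (hincenterP n2 vT).
Qed.

End Vertices.

(** * The inscribed dual simplex *)

Section DualSimplex.
Context {R : realType} {n : nat}.
Implicit Types (x y p q : 'rV[R]_n) (v w : simplex R n).

(** The metric on chords at [q] in terms of Lorentz products of x, p and q, which isometries
    transform by multipliers: tangent vectors are moved without a derivative of [g]. *)
Lemma hmetricE q x p : hball q -> hmetric q (x - q) (p - q) =
  ((1 - dot x q) * (1 - dot p q) - (1 - dot x p) * (1 - dot q q)) / (1 - dot q q) ^+ 2.
Proof.
move=> /hballP q1; rewrite /hmetric !dotE (dotC q x) (dotC q p).
by field; lra.
Qed.

Lemma hmetric_perp q x p : hball q -> hmetric q (x - q) (p - q) = 0 <->
  (1 - dot x p) * (1 - dot q q) = (1 - dot x q) * (1 - dot p q).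
Proof.
move=> qb; have q1 : dot q q < 1 by apply/hballP.
rewrite hmetricE//; split => [/eqP|->]; last by rewrite subrr mul0r.
rewrite mulf_eq0 invr_eq0 expf_eq0/= [1 - dot q q == 0]gt_eqF ?orbF; last by lra.
by rewrite subr_eq0 => /eqP.
Qed.

Lemma isom_inscribed_dual g v a tau u k : total_simplex v -> is_isom g ->
  hball (hincenter v) ->
  g (hincenter v) = 0 -> 0 < tau -> tau < 1 ->
  barycentric (g \o v) a (fun=> tau) u ->
  hball (inscribed_dual v k) /\ g (inscribed_dual v k) = tau *: u k.
Proof.
move=> [vc vi] gi ob go tau0 tau1 wb; have [a0 u1 _ _ _] := wb.
have [g' [gi' g'g gg']] := isom_inverse gi.
set o := hincenter v in ob go *; have oc := hball_hcball ob.
set y := tau *: u k.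
have yy : dot y y = tau ^+ 2 by rewrite !dotE u1 mulr1 expr2.
have yb : hball y by apply/hballP; rewrite yy expr_lt1// ltW.
have yc := hball_hcball yb.
have wc i : hcball ((g \o v) i) by exact: isom_hcball.
suff -> : inscribed_dual v k = g' y by split; [exact: isom_hball|rewrite gg'].
apply: get_unique.
  have q'b := isom_hball gi' yb; split => //.
    have := isom_affine_span (z := face_vertices (g \o v) k) gi' (fun i => wc _) yc.
    rewrite (_ : g' \o _ = face_vertices v k); last first.
      by apply/funext => i; rewrite /face_vertices /= g'g.
    apply; apply/(barycentric_affine_face _ _ wb).
    by rewrite dotZr u1 mulr1.
  move=> x [r [r1 xE]]; apply/hmetric_perp => //; set q := g' y.
  (* Points of the affine span may leave the closed ball, where [g] is not controlled.
     Perpendicularity is transported at the vertices and extends to the span because [1 - dot x p]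
     is affine in x. *)
  have vq i : (1 - dot (face_vertices v k i) o) * (1 - dot q q) =
      (1 - dot (face_vertices v k i) q) * (1 - dot o q).
    have kl : lift k i != k by rewrite eq_sym neq_lift.
    have e : (1 - dot ((g \o v) (lift k i)) 0) * (1 - dot y y) =
        (1 - dot ((g \o v) (lift k i)) y) * (1 - dot 0 y).
      rewrite yy !(dot0l, dot0r) subr0 mul1r mulr1 dotZr dotC.
      by rewrite (barycentric_vertex wb)// expr2.
    have := isom_perp gi' (wc _) (hball_hcball (@hball0 _ _)) yc e.
    by rewrite /= g'g// -go g'g.
  have xF p : 1 - dot x p = \sum_i r i * (1 - dot (face_vertices v k i) p).
    rewrite xE dot_suml -[in LHS]r1 -sumrB; apply: eq_bigr => i _.
    by rewrite dotZl mulrBr mulr1.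
  rewrite !xF !mulr_suml; apply: eq_bigr => i _.
  by rewrite -!mulrA vq.
(* Uniqueness: the image of any foot is orthogonal to the facet as seen from 0, hence a multiple of
   [u k], and the offset [tau] fixes the multiple. *)
move=> q [qP qb qperp]; have qc := hball_hcball qb.
rewrite -(g'g q)//; congr g'.
have uq : dot (u k) (g q) = tau.
  apply/(barycentric_affine_face _ _ wb).
  have := isom_affine_span gi (fun i => vc _) qc qP; congr affine_span.
have qw j : j != k -> dot (g q) ((g \o v) j) = dot (g q) (g q).
  move=> jk.
  have vP : affine_span (face_vertices v k) (v j).
    have [i ->] : exists i, j = lift k i.
      by case: (unliftP k j) jk => [i ->|->]; [exists i|rewrite eqxx].
    exists (fun l => (l == i)%:R); rewrite sum_delta; split => //.
    by rewrite (sum_delta_scale (face_vertices v k)).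
  have /hmetric_perp := qperp _ vP => /(_ qb) e.
  have := isom_perp gi (vc j) oc qc e.
  rewrite go !(dot0l, dot0r) subr0 mul1r mulr1 => /addrI/oppr_inj ->.
  by rewrite dotC.
have [r yE _] := barycentric_normal wb qw.
by move: uq; rewrite yE dotZr u1 mulr1 => ->.
Qed.

(** The metric at the incenter on the chords to the dual vertices is [dot (u k) (u l)] times the
    positive lengths [m (d k) / m o * tau] and [m (d l) / m o * tau], which normalization to unit
    tangents cancels. *)
Lemma dual_cosE g v a tau u i j : total_simplex v -> is_isom g ->
  hball (hincenter v) ->
  g (hincenter v) = 0 -> 0 < tau -> tau < 1 ->
  barycentric (g \o v) a (fun=> tau) u -> dual_cos_mx v i j = dot (u i) (u j).
Proof.
move=> vT gi ob go tau0 tau1 wb; have [a0 u1 _ _ _] := wb.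
have oc := hball_hcball ob.
have dE k : g (inscribed_dual v k) = tau *: u k.
  by have [] := isom_inscribed_dual k vT gi ob go tau0 tau1 wb.
have db k : hcball (inscribed_dual v k).
  by have [/hball_hcball] := isom_inscribed_dual k vT gi ob go tau0 tau1 wb.
have [[m [mp conf _ _]] _] := isom_moebius gi.
set o := hincenter v in ob oc go *; set d := inscribed_dual v in dE db *.
have mo := mp o oc.
have h k l : hmetric o (d k - o) (d l - o) =
    (m (d k) / m o * tau) * (m (d l) / m o * tau) * dot (u k) (u l).
  have mk := mp _ (db k); have ml := mp _ (db l).
  have e1 : 1 - dot o o = m o ^+ 2.
    have := conf o o oc oc; rewrite go dot0l subr0 => /esym/divr1_eq ->.
    by rewrite expr2.
  have e2 s : 1 - dot (d s) o = m (d s) * m o.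
    have := conf (d s) o (db s) oc; rewrite go dot0r subr0 => /esym/divr1_eq ->.
    by [].
  have e3 : 1 - dot (d k) (d l) = m (d k) * m (d l) * (1 - tau ^+ 2 * dot (u k) (u l)).
    have := conf (d k) (d l) (db k) (db l); rewrite !dE dotZl dotZr mulrA -expr2 => ->.
    by field; rewrite !lt0r_neq0.
  rewrite hmetricE// e1 !e2 e3; field; lra.
have nd k : hnorm o (d k - o) = m (d k) / m o * tau.
  rewrite /hnorm h u1 mulr1 -expr2 sqrtr_sqr ger0_norm//.
  by rewrite mulr_ge0 ?divr_ge0 ?ltW// mp.
have hZ (r s : R) x y : hmetric o (r *: x) (s *: y) = r * s * hmetric o x y.
  by rewrite /hmetric !dotE; ring.
have he k l : hmetric o (dual_direction v k) (dual_direction v l) = dot (u k) (u l).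
  rewrite /dual_direction /unit_tangent -/o -/d hZ !nd h.
  have := mp _ (db k); have := mp _ (db l) => ? ?.
  by field; rewrite !lt0r_neq0.
rewrite mxE /dual_angle /hangle -/o /hnorm !he !u1 sqrtr1 mulr1 divr1 acosK//.
rewrite in_itv/= dot_unit_le1// andbT -[-1]opprK lerNl opprK -dotNl.
by apply: dot_unit_le1 => //; rewrite dotNl dotNr opprK.
Qed.

End DualSimplex.

(** * Incentred models *)

Section Correspondence.
Context {R : realType} {n : nat} (n2 : (2 <= n)%N).
Implicit Types (x y : 'rV[R]_n) (g h : 'rV[R]_n -> 'rV[R]_n) (v w : simplex R n).

(** Conjugating by [g] an element that fixes the incenter gives an isometry fixing 0, hence an
    orthogonal matrix. Both stabilizers are compared through the permutation of the vertices. *)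
Lemma incentred_stabilizer g v (f : 'rV[R]_n -> 'rV[R]_n) :
  total_simplex v -> is_isom g -> g (hincenter v) = 0 ->
  (exists2 h, hull_stabilizer v h & forall x, hcball x -> f (g x) = g (h x)) <->
  (exists2 A, orthogonal_stabilizer (g \o v) A & forall x, hcball x -> f x = x *m A).
Proof.
move=> vT gi go; have oc := hball_hcball (hincenter_hball n2 vT); have [vc vi] := vT.
have [g' [gi' g'g gg']] := isom_inverse gi.
have go' : g' 0 = hincenter v by rewrite -go g'g.
split=> [[h hs fE]|[A [oA Aw] fE]].
  have hi : is_isom h by case: hs.
  have hv := stabilizer_vertices vT hs.
  have [||A oA AE] := @isom_fix0 _ _ (g \o (h \o g')).
  - exact: isom_comp (isom_comp gi' hi) gi.
  - by rewrite /= go' (stabilizer_incenter n2 vT hs).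
  exists A; last first.
    move=> x xc; rewrite -AE//= -fE ?gg'//; exact: isom_hcball.
  have gA i : (g \o v) i *m A = g (h (v i)).
    by rewrite -AE /= ?g'g//; exact: isom_hcball.
  split => //; apply/seteqP; split => [_ [_ [i _ <-] <-]|_ [i _ <-]] /=.
    have [j _ e] : range v (h (v i)) by rewrite -hv; exists i.
    by exists j => //=; rewrite -[RHS]/((g \o v) i *m A) gA e.
  have [j _ e] : range (h \o v) (v i) by rewrite hv; exists i.
  by exists ((g \o v) j); [exists j|rewrite gA -e].
have Ai := isom_orthogonal oA.
pose h := g' \o (mulmxr A \o g).
have hi : is_isom h by exact: isom_comp (isom_comp gi Ai) gi'.
exists h; last first.
  move=> x xc; rewrite /h /= gg' ?fE//; first exact: isom_hcball.
  exact/(isom_hcball Ai)/isom_hcball.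
apply: range_stabilizer => //; apply/seteqP; split => [_ [i _ <-]|_ [i _ <-]].
  have [j _ e] : range (g \o v) ((g \o v) i *m A).
    by rewrite -Aw; exists ((g \o v) i) => //; exists i.
  by exists j => //; rewrite /h /= -[X in g' X]e /= g'g.
have [_ [j _ <-] e] : (mulmxr A @` range (g \o v)) ((g \o v) i) by rewrite Aw; exists i.
by exists j => //; rewrite /h /= -[LHS]/(g' ((mulmxr A) ((g \o v) j))) e /= g'g.
Qed.

(** Evaluating the partition of unity at 0 gives [tau^-1] for the sum of the [a j]; the weights of
    the Euclidean incenter are then the barycentric coordinates of 0. *)
Lemma balanced_euclidean_incenter w a tau u : barycentric w a (fun=> tau) u ->
  is_incenter setT eucl_dist w 0 /\ inradius setT eucl_dist w = tau.
Proof.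
move=> wb; have [_ _ s1 sx _] := wb; have [] := euclidean_incenter wb.
have sE : \sum_j a j = tau^-1.
  have := s1 0; under eq_bigr do rewrite dot0r subr0.
  by rewrite -mulr_suml => h; apply: (divr1_eq _); rewrite invrK.
have -> : \sum_k (a k / \sum_j a j) *: w k = 0.
  rewrite -[RHS]sx; apply: eq_bigr => k _.
  by rewrite sE invrK dot0r subr0.
by rewrite sE invrK.
Qed.

(** Uniqueness of the Euclidean incenter identifies 0 with the point at equal distance from all
    hyperplanes, so the offsets agree and [w] is balanced for the hyperbolic metric too. *)
Lemma inscribed_incentred_simplex w : inscribed_incentred w ->
  [/\ total_simplex w, ideal_simplex w & hincenter w = 0].
Proof.
move=> [wi ws w0]; have wc i : hcball (w i) by exact/hsphere_hcball/ws.
split => //; have [a [t [u wb]]] := barycentric_exists (ltnW n2) wi.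
have [a0 _ _ _ _] := wb.
have [/(incenter_unique w0) z0 _] := euclidean_incenter wb.
set S := \sum_j a j in z0.
have S0 : 0 < S by rewrite /S (bigD1 ord0)//= ltr_pwDl ?a0// sumr_ge0// => i _; apply/ltW.
have aS : \sum_k (a k / S) = 1 by rewrite -mulr_suml divff// gt_eqF.
have tE : t = (fun=> S^-1).
  apply/funext => k; have := barycentric_unique k wb aS z0.
  by rewrite dot0r subr0 => /(mulfI (lt0r_neq0 (a0 k))).
rewrite tE in wb; have S1 : 0 < S^-1 by rewrite invr_gt0.
by apply: hincenterE; have [] := balanced_hincenter n2 wc S1 wb.
Qed.

(** * Passage to isometry classes and orthogonal classes *)

Lemma orthogonal_class_mulmxr w (A : 'M[R]_n) : orthogonal_mx A ->
  orthogonal_class (mulmxr A \o w) = orthogonal_class w.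
Proof.
move=> oA; apply/seteqP; split => _ [B oB <-].
  exists (A *m B); first exact: orthogonal_mulmx.
  by apply/funext => i /=; rewrite mulmxA.
exists (A^T *m B); first exact/orthogonal_mulmx/oB/orthogonal_trmx.
by apply/funext => i /=; rewrite mulmxA -(mulmxA _ A) oA mulmx1.
Qed.

(** The model is well defined up to O(n): the isometry between two incentred positions fixes 0,
    hence is orthogonal. *)
Lemma orthogonal_class_incentred v w g h : total_simplex v -> total_simplex w ->
  is_isom g -> g (hincenter v) = 0 -> is_isom h -> h (hincenter w) = 0 ->
  isom_class v w -> orthogonal_class (g \o v) = orthogonal_class (h \o w).
Proof.
move=> vT wT gi g0 hi h0 [f fi fv]; have [vc _] := vT.
have [g' [gi' g'g gg']] := isom_inverse gi.
have go' : g' 0 = hincenter v by rewrite -g0 g'g//; exact/hball_hcball/hincenter_hball.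
have [||A oA AE] := @isom_fix0 _ _ (h \o (f \o g')).
- exact: isom_comp (isom_comp gi' fi) hi.
- by rewrite /= go' -isom_hincenter// fv.
rewrite -(orthogonal_class_mulmxr _ oA); congr orthogonal_class; apply/funext => i.
by rewrite /= -AE /= ?g'g -?fv//; exact: isom_hcball.
Qed.

Lemma isom_class_refl v : isom_class v v.
Proof. by exists id => //; exact: isom_id. Qed.

Lemma isom_class_sub v w : isom_class v w -> isom_class w `<=` isom_class v.
Proof.
move=> [g gi <-] _ [h hi <-]; exists (h \o g) => //; exact: isom_comp.
Qed.

Lemma isom_class_sym v w : total_simplex v -> isom_class v w -> isom_class w v.
Proof.
move=> [vc _] [g gi <-]; have [g' [gi' g'g gg']] := isom_inverse gi.
by exists g' => //; apply/funext => i /=; rewrite g'g.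
Qed.

End Correspondence.

Theorem corollary3p3 (R : realType) (n : nat) (hn : (2 <= n)%N) :
  (forall v : simplex R n, total_simplex v ->
     (exists2 g, is_isom g & g (hincenter v) = 0) /\
     (forall h, hull_stabilizer v h -> h (hincenter v) = hincenter v) /\
     forall g, is_isom g -> g (hincenter v) = 0 ->
       [/\ (* as sets of transformations of the closed ball, the conjugate by g
              of the stabilizer is the stabilizer of the model in O(n) *)
           forall f : 'rV[R]_n -> 'rV[R]_n,
             (exists2 h, hull_stabilizer v h &
                forall x, hcball x -> f (g x) = g (h x)) <->
             (exists2 A, orthogonal_stabilizer (g \o v) A &
                forall x, hcball x -> f x = x *m A),
           (forall k, enorm (g (inscribed_dual v k)) = tanh (hinradius v)) /\
           gram (g \o inscribed_dual v) =
             tanh (hinradius v) ^+ 2 *: dual_cos_mx v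
         & ideal_simplex v ->
             [/\ inscribed_incentred (g \o v),
                 inradius setT eucl_dist (g \o v) = tanh (hinradius v)
               & euclidean_dual_gram (g \o v) = dual_cos_mx v]]) /\
  (exists Phi : set (simplex R n) -> set (simplex R n),
     set_bij [set isom_class v | v in
                [set v | total_simplex v /\ ideal_simplex v]]
             [set orthogonal_class w | w in [set w | inscribed_incentred w]]
             Phi /\
     forall (v : simplex R n) g, total_simplex v -> ideal_simplex v ->
       is_isom g -> g (hincenter v) = 0 ->
       Phi (isom_class v) = orthogonal_class (g \o v)).
Proof.
have incentred (v : simplex R n) g : total_simplex v -> ideal_simplex v ->
    is_isom g -> g (hincenter v) = 0 -> inscribed_incentred (g \o v).
  move=> vT vs gi g0.
  have [tau [a [u [tau0 tau1 wb rE]]]] := incentred_barycentric hn vT gi g0.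
  split; first by have [] := isom_total gi vT.
    exact: isom_ideal.
  by have [] := balanced_euclidean_incenter wb.
have centre (v : simplex R n) : total_simplex v ->
    exists2 g, is_isom g & g (hincenter v) = 0.
  move=> vT; have vb := hincenter_hball hn vT.
  by exists (boost (hincenter v)); [exact: isom_boost|exact: boost_self].
split.
  move=> v vT; have vb := hincenter_hball hn vT.
  split; first exact: centre.
  split; first by move=> h; exact: stabilizer_incenter.
  move=> g gi g0.
  have [tau [a [u [tau0 tau1 wb ->]]]] := incentred_barycentric hn vT gi g0.
  have dE k : g (inscribed_dual v k) = tau *: u k.
    by have [] := isom_inscribed_dual k vT gi vb g0 tau0 tau1 wb.
  have [_ u1 _ _ _] := wb.
  split; first by move=> f; exact: incentred_stabilizer.
    split=> [k|].
      by rewrite dE /enorm !dotE u1 mulr1 -expr2 sqrtr_sqr ger0_norm// ltW.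
    apply/matrixP => i j; rewrite [LHS]mxE [RHS]mxE (dual_cosE _ _ vT gi vb g0 tau0 tau1 wb).
    by rewrite /= !dE !dotE mulrA -expr2.
  move=> vs; split; first exact: incentred.
    by have [] := balanced_euclidean_incenter wb.
  apply/matrixP => i j; rewrite mxE (dual_cosE _ _ vT gi vb g0 tau0 tau1 wb).
  by rewrite !(outward_normalE _ (ltnW hn) wb).
(* [Phi] collects the models of all representatives under all incentring isometries, so no choice is
   made; [PhiE] shows that they fill exactly one orthogonal class. *)
pose Phi (C : set (simplex R n)) : set (simplex R n) :=
  [set x | exists v g, [/\ total_simplex v /\ ideal_simplex v, is_isom g,
     g (hincenter v) = 0, isom_class v = C & orthogonal_class (g \o v) x]].
have PhiE (v : simplex R n) g : total_simplex v -> ideal_simplex v ->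
    is_isom g -> g (hincenter v) = 0 -> Phi (isom_class v) = orthogonal_class (g \o v).
  move=> vT vs gi g0; apply/seteqP; split => [x [w [h [[wT ws] hi h0 wv]]]|x vx].
    rewrite (orthogonal_class_incentred hn vT wT gi g0 hi h0)// -wv.
    exact: isom_class_refl.
  by exists v, g.
exists Phi; split => //; split.
- move=> _ [v [vT vs] <-]; have [g gi g0] := centre v vT.
  by rewrite (PhiE _ g)//; exists (g \o v) => //; exact: incentred.
(* Injectivity: an orthogonal map from the model of [w] to that of [v], followed by the inverse of
   the incentring of [v], joins the two simplices. *)
- move=> _ _ /[!inE] -[v [vT vs] <-] [w [wT ws] <-].
  have [g gi g0] := centre v vT; have [h hi h0] := centre w wT.
  rewrite (PhiE _ g)// (PhiE _ h)// => e.
  have [A oA Ae] : orthogonal_class (h \o w) (g \o v).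
    rewrite -e; exists 1%:M; first by rewrite /orthogonal_mx trmx1 mulmx1.
    by apply/funext => i /=; rewrite mulmx1.
  have [g' [gi' g'g gg']] := isom_inverse gi; have [vc _] := vT.
  have wv : isom_class w v.
    exists (g' \o (mulmxr A \o h)).
      exact: isom_comp (isom_comp hi (isom_orthogonal oA)) gi'.
    apply/funext => i; rewrite -[RHS](g'g (v i))//.
    by rewrite -[g (v i)]/((g \o v) i) -Ae.
  by apply/seteqP; split; apply: isom_class_sub => //; exact: isom_class_sym.
(* Surjectivity: an inscribed incentred simplex is its own model, with the identity as incentring
   isometry. *)
- move=> _ [w wi <-]; have [wT ws w0] := inscribed_incentred_simplex hn wi.
  exists (isom_class w); first by exists w.
  by rewrite (PhiE _ id)//; exact: isom_id.
Qed.
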